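(* Let $R(\lambda)=\lambda(5-\lambda)$, let $\mathcal{J}$ be the Julia set of $R$, and let $\Sigma_6=\{6\}\cup\bigcup_{m=0}^\infty R^{\circ -m}\{3\}$. For every $\omega\in\{0,1,2\}^\infty$ and every $1\le p\le\infty$, the spectrum of the Laplacian $\Delta:\ell^p(L_\omega)\to\ell^p(L_\omega)$ on the Sierpinski lattice $L_\omega$ is equal to $\mathcal{J}\cup\Sigma_6$.
   Context: Sierpinski lattice: let $F_0(x)=\frac12x+(\frac14,\frac{\sqrt3}{4})$, $F_1(x)=\frac12x$, $F_2(x)=\frac12x+(\frac12,0)$ on $\mathbb{R}^2$, with fixed points $q_0=(\frac12,\frac{\sqrt3}{2})$, $q_1=(0,0)$, $q_2=(1,0)$. Put $V_0=\{q_0,q_1,q_2\}$ and $V_m=\bigcup_{i=0}^2F_i(V_{m-1})$ for $m\ge1$. For an infinite word $\omega=\omega_1\omega_2\cdots\in\{0,1,2\}^\infty$, the Sierpinski lattice is the infinite graph with vertex set $L_\omega=\bigcup_{m=1}^\infty F_{\omega_1}^{-1}\cdots F_{\omega_m}^{-1}(V_m)$, where distinct $x,y\in L_\omega$ are neighbours, written $x\sim y$, if $x,y\in F_{\omega_1}^{-1}\cdots F_{\omega_m}^{-1}F_{l_m}F_{l_{m-1}}\cdots F_{l_1}(V_0)$ for some $m\geq 1$ and $l_1,\dots,l_m\in\{0,1,2\}$. Every vertex has four neighbours except a boundary vertex (boundary point), which has exactly two; a lattice has either no boundary vertex or exactly one. Laplacian: $\Delta f(x)=\sum_{y\sim x}f(y)-4f(x)$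 if $x$ is not a boundary point, and $\Delta f(x)=\sum_{y\sim x}2f(y)-4f(x)$ if $x$ is a boundary point. Convention: the spectrum is $\{\lambda\in\mathbb{C}:\lambda+\Delta\text{ is not invertible}\}$ (i.e. it is the spectrum of $-\Delta$). The Julia set $\mathcal{J}$ of $R$ is the complement of the Fatou set of $R$ on the Riemann sphere; here equivalently $\mathcal{J}=\{x\in\mathbb{C}:\sup_{k\ge0}|R^{\circ k}(x)|<\infty\}$. $R^{\circ k}$ is the $k$-fold iterate and $R^{\circ-m}\{a\}=\{\lambda\in\mathbb{C}:R^{\circ m}(\lambda)=a\}$. *)

(* Defs.v *)
From HB Require Import structures.
From mathcomp Require Import all_boot all_order all_algebra.
From mathcomp Require Import complex.
From mathcomp Require Import all_classical all_reals all_analysis.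

Set Implicit Arguments.
Unset Strict Implicit.
Unset Printing Implicit Defensive.

Import Order.TTheory GRing.Theory Num.Theory.

Local Open Scope classical_set_scope.
Local Open Scope ring_scope.

Section Lattice.
Variable R : realType.

Definition q (i : 'I_3) : R * R :=
  match val i with
  | 0%N => (1 / 2, Num.sqrt 3 / 2)
  | 1%N => (0, 0)
  | _ => (1, 0)
  end.

Definition trans (i : 'I_3) : R * R :=
  match val i with
  | 0%N => (1 / 4, Num.sqrt 3 / 4)
  | 1%N => (0, 0)
  | _ => (1 / 2, 0)
  end.

Definition F (i : 'I_3) (x : R * R) : R * R :=
  (1 / 2 * x.1 + (trans i).1, 1 / 2 * x.2 + (trans i).2).

Fixpoint V (m : nat) : set (R * R) :=
  if m is m'.+1 then \bigcup_(i in [set: 'I_3]) (F i @` V m') else range q.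

(* Infinite words are indexed from 0: [omega k] is the letter omega_(k+1).
   [blowup omega m A] is F_(omega_1)^-1 ... F_(omega_m)^-1 (A); the maps F i
   being bijective, images under F i ^-1 are preimages under F i. *)
Fixpoint blowup (omega : nat -> 'I_3) (m : nat) (A : set (R * R)) :
    set (R * R) :=
  if m is m'.+1 then blowup omega m' (F (omega m') @^-1` A) else A.

(* F_(l_m) ... F_(l_1) (V_0) for l = [:: l_1; ...; l_m] *)
Definition cell (l : seq 'I_3) : set (R * R) :=
  foldl (fun A i => F i @` A) (V 0) l.

Variable omega : nat -> 'I_3.

Definition lattice : set (R * R) :=
  \bigcup_(m in [set m : nat | (1 <= m)%N]) blowup omega m (V m).

Definition adj (x y : lattice) : Prop :=
  x <> y /\
  exists (m : nat) (l : m.-tuple 'I_3),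
    [/\ (1 <= m)%N, blowup omega m (cell l) (val x)
      & blowup omega m (cell l) (val y)].

Definition neighbours (x : lattice) : set lattice := [set y | adj x y].

Definition boundary (x : lattice) : Prop := (neighbours x #= `I_2)%card.

(* Neighbourhoods are finite, so the finite-support sums below are the genuine
   sums over all neighbours. *)
Definition Laplacian (f : lattice -> R[i]) (x : lattice) : R[i] :=
  if `[< boundary x >] then \sum_(y \in neighbours x) (2 * f y) - 4 * f x
  else \sum_(y \in neighbours x) f y - 4 * f x.

End Lattice.

Section Operators.
Variables (R : realType) (X : choiceType) (p : \bar R).
Local Notation C := R[i].
Local Notation modulus z := (complex.ComplexField.Normc.normc z).

(* Only used for 1 <= p; the value at p = -oo is a dummy. *)
Definition lpnorm (f : X -> C) : \bar R :=
  match p with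
  | r%:E => ((\esum_(x in [set: X]) (modulus (f x) `^ r)%:E) `^ r^-1)%E
  | +oo%E => ereal_sup [set (modulus (f x))%:E | x in [set: X]]
  | -oo%E => 0%E
  end.

Definition lp : set (X -> C) := [set f | (lpnorm f < +oo)%E].

(* [T] restricts to a bounded linear operator lp -> lp; its values outside lp
   are irrelevant. *)
Definition bounded_operator (T : (X -> C) -> (X -> C)) : Prop :=
  [/\ forall f, lp f -> lp (T f),
      forall (a : C) f g, lp f -> lp g ->
        T (fun x => a * f x + g x) = (fun x => a * T f x + T g x)
    & exists M : R, forall f, lp f -> (lpnorm (T f) <= M%:E * lpnorm f)%E].

(* Invertibility in the algebra of bounded operators on lp. *)
Definition invertible_operator (T : (X -> C) -> (X -> C)) : Prop :=
  bounded_operator T /\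
  exists S : (X -> C) -> (X -> C),
    [/\ bounded_operator S,
        forall f, lp f -> S (T f) = f
      & forall f, lp f -> T (S f) = f].

(* Sign convention for Laplacians: with the usual convention this is the
   spectrum of - D. *)
Definition spectrum (D : (X -> C) -> (X -> C)) : set C :=
  [set lambda |
    ~ invertible_operator (fun f x => lambda * f x + D f x)].

End Operators.

Section Dynamics.
Variable R : realType.
Local Notation C := R[i].
Local Notation modulus z := (complex.ComplexField.Normc.normc z).

(* The Riemann sphere: [Some z] is the finite point z, [None] is infinity. *)
Definition sphere : Type := option C.

Definition chordal (P Q : sphere) : R :=
  match P, Q with
  | Some z, Some w =>
      2 * modulus (z - w)
      / (Num.sqrt (1 + modulus z ^+ 2) * Num.sqrt (1 + modulus w ^+ 2))
  | Some z, None | None, Some z => 2 / Num.sqrt (1 + modulus z ^+ 2)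
  | None, None => 0
  end.

Definition chordal_open (U : set sphere) : Prop :=
  forall P, U P ->
    exists2 d : R, 0 < d & forall Q, chordal P Q < d -> U Q.

Definition equicontinuous_iterates (g : sphere -> sphere) (P : sphere) : Prop :=
  forall e : R, 0 < e ->
    exists2 d : R, 0 < d &
      forall Q, chordal P Q < d ->
        forall k : nat, chordal (iter k g P) (iter k g Q) < e.

(* The largest open set on which the iterates of g are equicontinuous for the
   chordal metric (equivalently, by Arzela-Ascoli, form a normal family). *)
Definition Fatou (g : sphere -> sphere) : set sphere :=
  \bigcup_(U in [set U | chordal_open U /\
                         forall P, U P -> equicontinuous_iterates g P]) U.

Definition Julia (g : sphere -> sphere) : set sphere := ~` Fatou g.

Definition Rmap (lambda : C) : C := lambda * (5 - lambda).

(* Rmap is a nonconstant polynomial, hence extends to the sphere by fixing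
   infinity. *)
Definition Rsphere : sphere -> sphere := omap Rmap.

Definition Sigma6 : set C :=
  [set 6] `|` \bigcup_(m in [set: nat]) [set lambda | iter m Rmap lambda = 3].

End Dynamics.

(* Main.v *)
(* Encode a smallest triangle of the lattice by the infinite word l of its
   address, which agrees with omega far out, and let flip (l, i) be the
   neighbouring triangle across corner i.  With T summing a function over the
   corners of each triangle and T^* over the triangles at each vertex,
   Delta + 6 = T^* T, also at the boundary, where the only triangle counts
   twice, and T T^* = A + 3, with A the adjacency operator of the graph of
   triangles.  So for lambda != 6 everything reduces to A + lambda - 3 on words.
   The triangles come in blocks of three, the words with a common shift, and
   A + 1 = 3 E + P with E the averaging over blocks and P the involution
   exchanging each triangle with its neighbour outside the block.  Eliminating P
   shows that for lambda outside {3, 5} the operator at lambda on the lattice of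
   omega is invertible if the one at R(lambda) on the lattice of shift omega is,
   and that kernels lift in the same way.  If the orbit of lambda is unbounded
   and avoids 3, the operator is invertible far along the orbit by a Neumann
   series, hence at lambda.  Conversely 6 and 3 have eigenfunctions supported
   around a hexagon, so all preimages of 3 are eigenvalues, and they accumulate
   at every point with bounded orbit because R is expanding there. *)

Require Import Defs.
From HB Require Import structures.
From mathcomp Require Import all_boot all_order all_algebra.
From mathcomp Require Import complex finmap.
From mathcomp Require Import all_classical all_reals all_analysis.
From mathcomp Require Import ring lra zify.

Set Implicit Arguments.
Unset Strict Implicit.
Unset Printing Implicit Defensive.

Import Order.TTheory GRing.Theory Num.Theory.

Local Open Scope classical_set_scope.
Local Open Scope ring_scope.

Local Notation modulus z := (complex.ComplexField.Normc.normc z).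

(** * Addresses of triangles *)

Definition word := nat -> 'I_3.

Definition consw (i : 'I_3) (l : word) : word :=
  fun n => if n is n'.+1 then l n' else i.

Definition shift (l : word) : word := fun n => l n.+1.

Lemma consw_shift (l : word) : consw (l 0%N) (shift l) = l.
Proof. by apply/funext => -[]. Qed.

Lemma shift_consw (i : 'I_3) (l : word) : shift (consw i l) = l.
Proof. by []. Qed.

(* [i^k j l_(k+1) ...] becomes [j^k i l_(k+1) ...]. *)
Definition swap_prefix (l : word) (i : 'I_3) (k : nat) : word :=
  fun n => if (n < k)%N then l k else if n == k then i else l n.

(* A word [l] encodes a smallest triangle of the lattice and [(l, i)] its
   corner [i]; [flip] gives the other encoding of the same vertex.  Its fixed
   points, the pairs with [l] constantly equal to [i], encode the boundary. *)
Definition flip (c : word * 'I_3) : word * 'I_3 :=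
  if pselect (exists k, c.1 k != c.2) is left ex then
    (swap_prefix c.1 c.2 (ex_minn ex), c.1 (ex_minn ex))
  else c.

Lemma flip_const (l : word) (i : 'I_3) :
  (forall k, l k = i) -> flip (l, i) = (l, i).
Proof.
move=> li; rewrite /flip; case: pselect => // ex; exfalso.
by case: ex => k /=; rewrite li eqxx.
Qed.

Lemma flip_swap (l : word) (i : 'I_3) (k : nat) :
  (forall n, (n < k)%N -> l n = i) -> l k != i ->
  flip (l, i) = (swap_prefix l i k, l k).
Proof.
move=> lt_k lk; rewrite /flip; case: pselect => [ex|[]]; last by exists k.
suff -> : ex_minn ex = k by [].
case: ex_minnP => m /= lm min_m; apply/eqP; rewrite eqn_leq; apply/andP; split; first exact: min_m.
by rewrite leqNgt; apply/negP => /lt_k; exact/eqP.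
Qed.

Lemma flip_cases (l : word) (i : 'I_3) :
  (forall k, l k = i) \/
  exists k, (forall n, (n < k)%N -> l n = i) /\ l k != i.
Proof.
have [ex|no] := pselect (exists k, l k != i); [right|left] => [|k].
  exists (ex_minn ex); case: ex_minnP => m lm min_m; split=> // n.
  by rewrite ltnNge => nm; apply/eqP; apply: contraNT nm => /min_m.
by apply/eqP; apply/negP => /negP lk; apply: no; exists k.
Qed.

Lemma flipK : involutive flip.
Proof.
move=> [l i]; have [li|[k [lt_k lk]]] := flip_cases l i; first by rewrite !flip_const.
rewrite (flip_swap lt_k lk) (@flip_swap _ _ k).
- by rewrite /swap_prefix ltnn eqxx; congr pair; apply/funext => n; case: ltngtP => [/lt_k||->].
- by move=> n nk; rewrite /swap_prefix nk.
- by rewrite /swap_prefix ltnn eqxx eq_sym.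
Qed.

Lemma flip_inj : injective flip. Proof. exact: inv_inj flipK. Qed.

Lemma flip_cons_neq (l : word) (i j : 'I_3) : j != i ->
  flip (consw j l, i) = (consw i l, j).
Proof.
move=> ji; rewrite (@flip_swap _ _ 0%N)//=.
by congr pair; apply/funext => -[].
Qed.

(** Corner [i] of the triangle [consw i l] is also corner [i] of the larger triangle [l], so its
    neighbour is found one level up, as the subtriangle sitting at the flipped corner. *)
Lemma flip_cons_eq (l : word) (i : 'I_3) :
  flip (consw i l, i) = (consw (flip (l, i)).2 (flip (l, i)).1, (flip (l, i)).2).
Proof.
have [li|[k [lt_k lk]]] := flip_cases l i.
  by rewrite !flip_const//; case.
rewrite (flip_swap lt_k lk) (@flip_swap _ _ k.+1)//=; last by case.
by congr pair; apply/funext => -[|n]//; rewrite /swap_prefix /= ltnS eqSS.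
Qed.

Lemma flip_neq (l : word) (i : 'I_3) : l 0%N != i ->
  flip (l, i) = (consw i (shift l), l 0%N).
Proof. by move=> li; rewrite -{1}(consw_shift l) flip_cons_neq. Qed.

Lemma flip_head (l : word) : let c := flip (shift l, l 0%N) in
  flip (l, l 0%N) = (consw c.2 c.1, c.2).
Proof. by rewrite /= -{1}(consw_shift l) flip_cons_eq. Qed.

Lemma flip_fst_fixed (l : word) (i : 'I_3) :
  (flip (l, i)).1 = l -> flip (l, i) = (l, i).
Proof.
have [/flip_const//|[k [lt_k lk]]] := flip_cases l i.
rewrite (flip_swap lt_k lk) /= => /(congr1 (@^~ k)).
by rewrite /swap_prefix ltnn eqxx => ik; rewrite -ik eqxx in lk.
Qed.

Lemma flip_snd_fixed (l : word) (i : 'I_3) :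
  (flip (l, i)).2 = i -> flip (l, i) = (l, i).
Proof.
have [/flip_const//|[k [lt_k lk]]] := flip_cases l i.
by rewrite (flip_swap lt_k lk) /= => ik; rewrite ik eqxx in lk.
Qed.

(* Two triangles share at most one vertex. *)
Lemma flip_fst_inj (l : word) (i j : 'I_3) :
  (flip (l, i)).1 = (flip (l, j)).1 -> i = j.
Proof.
wlog li : i j / l 0%N != i.
  move=> hw; have [li|] := eqVneq (l 0%N) i; last exact: hw.
  have [->//|ij] := eqVneq i j.
  by move=> e; apply/esym; apply: hw; rewrite ?li.
rewrite (flip_neq li) /=; have [<-|lj] := eqVneq (l 0%N) j; last first.
  by rewrite flip_neq//= => /(congr1 (@^~ 0%N)).
rewrite flip_head /= => e.
(* The flip at [i] stays in the block. If the flip at the head letter leads to the same triangle, it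
   fixes [shift l] and hence keeps the head letter, which the flip at [i] replaces by [i]. *)
have /flip_fst_fixed fx : (flip (shift l, l 0%N)).1 = shift l.
  by rewrite -[RHS](shift_consw i) e.
by move: e => /(congr1 (@^~ 0%N)); rewrite /= fx /=.
Qed.

(** The triangles of the lattice of [w] are the words with the tail of [w]. The operators on words
    below act on the triangles of all lattices at once, and this relation singles out one of
    them. *)
Definition tail_eq (l w : word) : Prop := exists m, forall k, (m <= k)%N -> l k = w k.

Lemma flip_tail (l w : word) (i : 'I_3) : tail_eq l w -> tail_eq (flip (l, i)).1 w.
Proof.
have [/flip_const->//|[k [lt_k lk]]] := flip_cases l i.
rewrite (flip_swap lt_k lk) => -[m tm] /=.
exists (maxn m k.+1) => n; rewrite geq_max => /andP[mn kn].
by rewrite /swap_prefix ltnNge ltnW//= gtn_eqF// tm.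
Qed.

Lemma tail_eq_shift (l w : word) : tail_eq (shift l) (shift w) <-> tail_eq l w.
Proof.
split=> -[m tm]; last by exists m => k mk; apply: tm; apply: leqW.
by exists m.+1 => -[//|k] mk; apply: tm.
Qed.

(** * Moduli and l^p norms *)

Section Modulus.
Variable R : realType.
Implicit Types z w : R[i].

Lemma modulusD z w : modulus (z + w) <= modulus z + modulus w.
Proof. exact: (@le_normcD R). Qed.

Lemma modulusN z : modulus (- z) = modulus z.
Proof. exact: (@normcN R). Qed.

Lemma modulusM z w : modulus (z * w) = modulus z * modulus w.
Proof. exact: ComplexField.Normc.normcM. Qed.

Lemma modulusV z : modulus z^-1 = (modulus z)^-1.
Proof. exact: ComplexField.Normc.normcV. Qed.

Lemma modulus0 : modulus (0 : R[i]) = 0.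
Proof. exact: ComplexField.Normc.normc0. Qed.

Lemma modulus1 : modulus (1 : R[i]) = 1.
Proof. exact: ComplexField.Normc.normc1. Qed.

Lemma modulus_ge0 z : 0 <= modulus z.
Proof. by case: z => a b /=; rewrite sqrtr_ge0. Qed.

Lemma modulus_eq0 z : (modulus z == 0) = (z == 0).
Proof.
apply/eqP/eqP => [|->]; last exact: modulus0.
exact: ComplexField.Normc.eq0_normc.
Qed.

Lemma modulus_gt0 z : (0 < modulus z) = (z != 0).
Proof. by rewrite lt0r modulus_eq0 modulus_ge0 andbT. Qed.

Lemma modulusX z n : modulus (z ^+ n) = modulus z ^+ n.
Proof. by elim: n => [|n IHn]; rewrite ?modulus1// !exprS modulusM IHn. Qed.

Lemma modulusB z w : modulus (z - w) = modulus (w - z).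
Proof. by rewrite -modulusN opprB. Qed.

Lemma modulus_leB z w : modulus z - modulus w <= modulus (z - w).
Proof. by have := modulusD (z - w) w; rewrite subrK; lra. Qed.

Lemma modulus_sum (I : Type) (s : seq I) (P : pred I) (h : I -> R[i]) :
  modulus (\sum_(i <- s | P i) h i) <= \sum_(i <- s | P i) modulus (h i).
Proof.
elim/big_rec2: _ => [|i x y _ xy]; first by rewrite modulus0.
by apply: le_trans (modulusD _ _) _; rewrite lerD2l.
Qed.

Lemma modulus_natr n : modulus (n%:R : R[i]) = n%:R.
Proof.
have -> : n%:R = Complex (n%:R : R) 0 by elim: n => [|n IHn]//; rewrite !mulrSr IHn; simpc.
by rewrite /= expr0n addr0 sqrtr_sqr ger0_norm.
Qed.

End Modulus.

(** Absorbs a factor of an [r]-th power sum into the norm bound; the loss in the constant is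
    harmless. *)
Lemma powR_mulr_ge {R : realType} (k a r : R) : 1 <= k -> 0 <= a -> 1 <= r ->
  k * a `^ r <= (k * a) `^ r.
Proof.
move=> k1 a0 r1; rewrite powRM//; last exact: le_trans k1.
by rewrite ler_wpM2r ?powR_ge0// le1r_powR.
Qed.

(** * Norm bounds in l^p, uniformly in p *)

Section LpNorm.
Variables (R : realType) (p : \bar R).
Hypothesis p_ge1 : (1 <= p)%E.
Implicit Types X Y : choiceType.

(** Nonnegativity is a separate clause because the supremum norm over an empty type is [-oo]. *)
Definition lple (X : choiceType) (f : X -> R[i]) (K : R) : Prop :=
  0 <= K /\ (lpnorm p f <= K%:E)%E.

Lemma lpleP X (f : X -> R[i]) (K : R) : lple f K <-> 0 <= K /\
  match p with
  | r%:E => forall s, uniq s -> \sum_(x <- s) modulus (f x) `^ r <= K `^ r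
  | _ => forall x, modulus (f x) <= K
  end.
Proof.
suff H : 0 <= K -> (lpnorm p f <= K%:E)%E <-> match p with
  | r%:E => forall s, uniq s -> \sum_(x <- s) modulus (f x) `^ r <= K `^ r
  | _ => forall x, modulus (f x) <= K
  end by split=> -[K0 /(H K0)].
move=> K0; rewrite /lpnorm; case: p p_ge1 => [r||//] p1.
- have r1 : 1 <= r by rewrite -lee_fin.
  have r0 : r != 0 by rewrite gt_eqF//; lra.
  set E := (\esum_(x in _) _)%E.
  have E0 : (0 <= E)%E by apply: esum_ge0 => x _; rewrite lee_fin powR_ge0.
  have -> : (E `^ r^-1 <= K%:E)%E <-> (E <= (K `^ r)%:E)%E.
    split=> H.
      have := @gt0_ler_poweR _ r _ _ _ _ _ H; rewrite -poweRrM mulVf// poweRe1// poweR_EFin.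
      by apply; rewrite ?in_itv /= ?lee_fin ?leey ?poweR_ge0//; lra.
    have := @gt0_ler_poweR _ r^-1 _ _ _ _ _ H; rewrite poweR_EFin -powRrM mulfV// powRr1//.
    apply; rewrite ?in_itv /= ?lee_fin ?leey ?powR_ge0 ?andbT//.
    by rewrite invr_ge0; lra.
  split=> [EK s us|H].
    rewrite -lee_fin; apply: le_trans EK.
    rewrite fsbig_seq//= -fsumEFin//; apply: esum_ge.
    by exists [set` s].
  apply: ge_ereal_sup => _ [A [/finite_seqP[s ->] _] <-].
  rewrite fsumEFin// lee_fin.
  have -> : [set` s] = [set` undup s] by apply/seteqP; split=> x /=; rewrite mem_undup.
  by rewrite -fsbig_seq ?undup_uniq//; apply: H; exact: undup_uniq.
- split=> [H x|H].
    by rewrite -lee_fin; apply: le_trans H; apply: ereal_sup_ubound; exists x.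
  by apply: ge_ereal_sup => _ [x _ <-]; rewrite lee_fin.
Qed.

Lemma lpleW X (f : X -> R[i]) (K K' : R) : K <= K' -> lple f K -> lple f K'.
Proof.
move=> KK' [K0 fK]; split; first exact: le_trans KK'.
by apply: le_trans fK _; rewrite lee_fin.
Qed.

Lemma lp_lple X (f : X -> R[i]) : lp p f <-> exists K, lple f K.
Proof.
split=> [|[K [K0 fK]]]; last by apply: le_lt_trans fK _; exact: ltry.
rewrite /lp /=; case E : (lpnorm p f) => [r||]// _.
  by exists `|r|; split; rewrite ?E ?normr_ge0// lee_fin ler_norm.
by exists 0; split; rewrite ?E ?leNye.
Qed.

Lemma lple_le X (f : X -> R[i]) (K : R) x : lple f K -> modulus (f x) <= K.
Proof.
move/lpleP => []; case: p p_ge1 => [r||//] p1 K0; last exact.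
have r1 : 1 <= r by rewrite -lee_fin.
move/(_ [:: x] isT); rewrite big_seq1; rewrite leNgt => /negP fK.
rewrite leNgt; apply/negP => Kf; apply: fK.
by apply: gt0_ltr_powR; rewrite ?nnegrE ?modulus_ge0//; lra.
Qed.

(** The point of [X] excludes the value [-oo] of an empty supremum. *)
Lemma lple_exact X (f : X -> R[i]) : lp p f -> X -> exists2 K, lple f K & lpnorm p f = K%:E.
Proof.
move=> /lp_lple[K fK] x; have /(lple_le x) := fK => fxK.
move: (fK) => [K0]; case E : (lpnorm p f) => [r||]// rK.
  exists r => //; split; last by rewrite E.
  rewrite leNgt; apply/negP => r0; move: E; rewrite /lpnorm; case: p p_ge1 => [q||//] p1.
    set E := (_ `^ _)%E => /(congr1 (fun y => (0 <= y)%E)).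
    by rewrite poweR_ge0 lee_fin leNgt r0.
  move=> /(congr1 (fun y => ((modulus (f x))%:E <= y)%E)).
  rewrite ereal_sup_ubound; last by exists x.
  by rewrite lee_fin => /esym; have := modulus_ge0 (f x); lra.
move: E; rewrite /lpnorm; case: p p_ge1 => [q||//] p1.
  by set E := (_ `^ _)%E => /(congr1 (fun y => (0 <= y)%E)); rewrite poweR_ge0.
move=> /(congr1 (fun y => ((modulus (f x))%:E <= y)%E)).
by rewrite ereal_sup_ubound//; exists x.
Qed.

(** The label [psi] separates the points of each fibre of [phi] in [D], so fibres have at most three
    points and power sums grow by a factor of at most 3. *)
Lemma lple_reindex X Y (phi : Y -> X) (psi : Y -> 'I_3) (D : pred Y)
    (f : X -> R[i]) (g : Y -> R[i]) (K : R) :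
  {in D &, injective (fun y => (phi y, psi y))} ->
  (forall y, y \in D -> modulus (g y) <= modulus (f (phi y))) ->
  (forall y, y \notin D -> g y = 0) ->
  lple f K -> lple g (3 * K).
Proof.
move=> inj le_gf g0 /lpleP[K0 fK]; apply/lpleP; split; first lra.
case: p p_ge1 fK => [r||//] p1 fK; last first.
  move=> y; case: (boolP (y \in D)) => [/le_gf|/g0->]; last by rewrite modulus0; lra.
  by move: (fK (phi y)); have := modulus_ge0 (f (phi y)); lra.
have r1 : 1 <= r by rewrite -lee_fin.
move=> s us; rewrite (bigID (mem D)) /= [X in _ + X]big1 ?addr0; last first.
  by move=> y /g0 ->; rewrite modulus0 powR0// gt_eqF//; lra.
apply: (le_trans (y := \sum_(y <- s | y \in D) modulus (f (phi y)) `^ r)).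
  apply: ler_sum => y Dy; apply: ge0_ler_powR; rewrite ?nnegrE ?modulus_ge0//; first lra.
  exact: le_gf.
rewrite (partition_big psi xpredT)//=.
apply: (le_trans (y := \sum_(j < 3) K `^ r)); last first.
  rewrite sumr_const card_ord -[X in X <= _]mulr_natl; apply: powR_mulr_ge => //.
  by rewrite ler1n.
apply: ler_sum => j _; rewrite -big_filter.
rewrite -(big_map phi xpredT (fun x => modulus (f x) `^ r)); apply: (fK _).
rewrite map_inj_in_uniq ?filter_uniq// => y z; rewrite !mem_filter.
move=> /andP[/andP[yD /eqP yj] _] /andP[/andP[zD /eqP zj] _] yz.
by apply: inj => //; rewrite yz yj zj.
Qed.

(** A crude substitute for Minkowski's inequality: [|a + b|^r <= 2^r (|a|^r + |b|^r)] gives one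
    factor 2, and adding the two power sums gives another. *)
Lemma lpleD X (f g : X -> R[i]) (K L : R) :
  lple f K -> lple g L -> lple (fun x => f x + g x) (4 * (K + L)).
Proof.
move=> /lpleP[K0 fK] /lpleP[L0 gL]; apply/lpleP; split; first lra.
case: p p_ge1 fK gL => [r||//] p1 fK gL; last first.
  by move=> x; have := modulusD (f x) (g x); move: (fK x) (gL x); lra.
have r1 : 1 <= r by rewrite -lee_fin.
have r0 : 0 <= r by lra.
move=> s us; have {}fK := fK s us; have {}gL := gL s us.
apply: (le_trans (y := \sum_(x <- s) 2 `^ r * (modulus (f x) `^ r + modulus (g x) `^ r))).
  apply: ler_sum => x _; have := modulusD (f x) (g x).
  move: (modulus_ge0 (f x)) (modulus_ge0 (g x)) (modulus_ge0 (f x + g x)).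
  move: (modulus (f x)) (modulus (g x)) (modulus (f x + g x)) => a b c a0 b0 c0 cab.
  wlog ab : a b a0 b0 cab / a <= b.
    by move=> hw; case: (leP a b) => [|/ltW] /hw; [|rewrite addrC (addrC (a `^ r))]; apply.
  apply: (le_trans (y := (2 * b) `^ r)).
    by apply: ge0_ler_powR; rewrite ?nnegrE//; lra.
  by rewrite powRM// ler_wpM2l ?powR_ge0// lerDr powR_ge0.
rewrite -big_distrr big_split /=.
have KL0 : 0 <= K + L by lra.
apply: (le_trans (y := 2 `^ r * (2 * (K + L) `^ r))).
  rewrite ler_wpM2l ?powR_ge0//.
  have : K `^ r <= (K + L) `^ r by apply: ge0_ler_powR; rewrite ?nnegrE//; lra.
  have : L `^ r <= (K + L) `^ r by apply: ge0_ler_powR; rewrite ?nnegrE//; lra.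
  by lra.
have -> : 4 * (K + L) = 2 * (2 * (K + L)) by ring.
rewrite (powRM _ (_ : 0 <= 2))//; last by lra.
by rewrite ler_wpM2l ?powR_ge0// powR_mulr_ge//; lra.
Qed.

Lemma lpleZ X (f : X -> R[i]) (K : R) (a : R[i]) :
  lple f K -> lple (fun x => a * f x) (modulus a * K).
Proof.
move=> /lpleP[K0 fK]; have a0 := modulus_ge0 a.
apply/lpleP; split; first exact: mulr_ge0.
case: p p_ge1 fK => [r||//] p1 fK; last by move=> x; rewrite modulusM ler_wpM2l.
move=> s us; rewrite powRM//.
apply: (le_trans (y := \sum_(x <- s) modulus a `^ r * modulus (f x) `^ r)).
  by apply: ler_sum => x _; rewrite modulusM powRM// modulus_ge0.
by rewrite -big_distrr /= ler_wpM2l ?powR_ge0// fK.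
Qed.

Lemma lple0 X : lple (fun _ : X => 0 : R[i]) 0.
Proof.
apply/lpleP; split=> //; case: p p_ge1 => [r||//] p1; last by move=> x; rewrite modulus0.
have r1 : 1 <= r by rewrite -lee_fin.
by move=> s us; rewrite big1 ?powR_ge0// => x _; rewrite modulus0 powR0// gt_eqF//; lra.
Qed.

(** The successor keeps the factor at least 1 even when [s] is empty. *)
Lemma lple_fin_supp X (f : X -> R[i]) (s : seq X) (K : R) : 0 <= K ->
  (forall x, x \notin s -> f x = 0) -> (forall x, modulus (f x) <= K) ->
  lple f ((size s).+1%:R * K).
Proof.
move=> K0 f0 fK; apply/lpleP; split; first exact: mulr_ge0.
case: p p_ge1 => [r||//] p1; last first.
  by move=> x; apply: le_trans (fK x) _; rewrite ler_peMl// ler1n.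
have r1 : 1 <= r by rewrite -lee_fin.
move=> t ut; apply: le_trans (powR_mulr_ge _ _ _) => //; last by rewrite ler1n.
rewrite (bigID (mem s)) /= [X in _ + X]big1 ?addr0; last first.
  by move=> y /f0 ->; rewrite modulus0 powR0// gt_eqF//; lra.
apply: (le_trans (y := \sum_(i <- t | i \in s) K `^ r)).
  by apply: ler_sum => x _; apply: ge0_ler_powR; rewrite ?nnegrE ?modulus_ge0//; lra.
rewrite -big_filter big_const_seq count_predT iter_addr_0 -[X in X <= _]mulr_natl.
rewrite ler_wpM2r ?powR_ge0// ler_nat.
apply: leqW; apply: uniq_leq_size; first exact: filter_uniq.
by move=> x; rewrite mem_filter => /andP[].
Qed.

Lemma lp_fin_supp X (f : X -> R[i]) (s : seq X) :
  (forall x, x \notin s -> f x = 0) -> lp p f.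
Proof.
move=> f0; pose K := \sum_(x <- undup s) modulus (f x).
have K0 : 0 <= K by apply: sumr_ge0 => x _; exact: modulus_ge0.
apply/lp_lple; exists ((size s).+1%:R * K); apply: lple_fin_supp => // x.
have [xs|/f0->] := boolP (x \in s); last by rewrite modulus0.
rewrite /K (bigD1_seq x) ?undup_uniq ?mem_undup//= lerDl.
by apply: sumr_ge0 => y _; exact: modulus_ge0.
Qed.

(** Finite sets decide the bound. On a finite set the limit agrees with some [g n] plus a correction
    supported there, and a small enough uniform error makes the norm of this correction at most
    1. *)
Lemma lple_uniform_lim X (g : nat -> X -> R[i]) (h : X -> R[i]) (K : R) :
  (forall n, lple (g n) K) ->
  (forall e : R, 0 < e -> exists n, forall x, modulus (h x - g n x) <= e) ->
  lple h (4 * (K + 1)).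
Proof.
move=> gK gh; have K0 : 0 <= K by case: (gK 0%N).
have approx (s : seq X) : exists h', lple h' (4 * (K + 1)) /\ {in s, h' =1 h}.
  have [|n gn] := gh (size s).+1%:R^-1; first by rewrite invr_gt0.
  pose d x := if x \in s then h x - g n x else 0.
  exists (fun x => g n x + d x); split; last by move=> x xs; rewrite /d xs addrC subrK.
  rewrite -{2}(@mulfV R (size s).+1%:R)//.
  apply: lpleD => //; apply: lple_fin_supp; first by rewrite invr_ge0.
    by move=> x /negbTE; rewrite /d => ->.
  by move=> x; rewrite /d; case: ifP => // _; rewrite modulus0 invr_ge0.
have {}approx (s : seq X) : exists h', match p with
    | r%:E => forall t, uniq t -> \sum_(x <- t) modulus (h' x) `^ r <= (4 * (K + 1)) `^ r
    | _ => forall x, modulus (h' x) <= 4 * (K + 1)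
    end /\ {in s, h' =1 h}.
  by have [h' [/lpleP[_ h'K] h'h]] := approx s; exists h'.
apply/lpleP; split; first lra.
case: p p_ge1 approx => [r||//] p1 approx; last first.
  by move=> x; have [h' [h'K h'h]] := approx [:: x]; rewrite -h'h ?mem_head.
move=> s us; have [h' [h'K h'h]] := approx s.
by rewrite -(eq_big_seq _ (fun x xs => congr1 (fun z => modulus z `^ r) (h'h x xs))) h'K.
Qed.

End LpNorm.

(** * Bounded maps and spectral decimation *)

Section Limits.
Variable R : realType.

(** The intervals of radius [2 K / 2^n] around [x n] are nested, and the limit is the supremum of
    their left ends. *)
Lemma real_geometric_lim (x : nat -> R) (K : R) :
  (forall n, `|x n.+1 - x n| <= K * (1 / 2) ^+ n) ->
  exists y, forall n, `|y - x n| <= 2 * K * (1 / 2) ^+ n.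
Proof.
move=> xK; pose r n : R := 2 * K * (1 / 2) ^+ n.
have rS n : r n = r n.+1 + K * (1 / 2) ^+ n by rewrite /r exprS; field.
have lo m n : x n - r n <= x (n + m)%N - r (n + m)%N.
  elim: m => [|m IHm]; first by rewrite addn0.
  apply: le_trans IHm _; rewrite addnS (rS (n + m)%N).
  by move: (xK (n + m)%N); rewrite ler_norml => /andP[]; lra.
have hi m n : x (n + m)%N + r (n + m)%N <= x n + r n.
  elim: m => [|m IHm]; first by rewrite addn0.
  apply: le_trans IHm; rewrite addnS (rS (n + m)%N).
  by move: (xK (n + m)%N); rewrite ler_norml => /andP[]; lra.
have r0 n : 0 <= r n.
  have K0 : 0 <= K by have := le_trans (normr_ge0 _) (xK 0%N); rewrite expr0 mulr1.
  by rewrite /r mulr_ge0 ?mulr_ge0 ?exprn_ge0//; lra.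
have le_lohi m n : x n - r n <= x m + r m.
  have := lo m n; have := hi n m; rewrite addnC.
  by have := r0 (n + m)%N; lra.
pose E : set R := range (fun n => x n - r n).
have E_ub m : ubound E (x m + r m) by move=> _ [n _ <-].
have E_sup : has_sup E by split; [exists (x 0%N - r 0%N), 0%N | exists (x 0%N + r 0%N)].
exists (sup E) => n; rewrite -/(r n) ler_norml.
have : x n - r n <= sup E by apply: ub_le_sup; [case: E_sup|exists n].
have : sup E <= x n + r n by apply: ge_sup; [case: E_sup|exact: E_ub].
by move=> ? ?; apply/andP; split; lra.
Qed.

Lemma modulus_le_ReIm (z : R[i]) : modulus z <= `|complex.Re z| + `|complex.Im z|.
Proof.
case: z => a b /=; rewrite -(@ger0_norm _ (`|a| + `|b|)) ?addr_ge0//.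
rewrite -sqrtr_sqr ler_sqrt ?sqr_ge0// sqrrD -(real_normK (num_real a)) -(real_normK (num_real b)).
by rewrite -addrA lerD2l lerDr mulrn_wge0// mulr_ge0.
Qed.

Lemma normRe_le_modulus (z : R[i]) : `|complex.Re z| <= modulus z.
Proof. by case: z => a b /=; rewrite -sqrtr_sqr ler_wsqrtr// lerDl sqr_ge0. Qed.

Lemma normIm_le_modulus (z : R[i]) : `|complex.Im z| <= modulus z.
Proof. by case: z => a b /=; rewrite -sqrtr_sqr ler_wsqrtr// lerDr sqr_ge0. Qed.

Lemma geometric_lim (z : nat -> R[i]) (K : R) :
  (forall n, modulus (z n.+1 - z n) <= K * (1 / 2) ^+ n) ->
  exists w, forall n, modulus (w - z n) <= 4 * K * (1 / 2) ^+ n.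
Proof.
move=> zK.
have [n|a za] := @real_geometric_lim (fun n => complex.Re (z n)) K.
  by apply: le_trans (zK n); rewrite -raddfB; exact: normRe_le_modulus.
have [n|b zb] := @real_geometric_lim (fun n => complex.Im (z n)) K.
  by apply: le_trans (zK n); rewrite -raddfB; exact: normIm_le_modulus.
exists (Complex a b) => n; apply: le_trans (modulus_le_ReIm _) _.
rewrite !raddfB /=; have := za n; have := zb n; lra.
Qed.

Lemma geometric_small (K e : R) : 0 < e -> exists n, K * (1 / 2) ^+ n <= e.
Proof.
move=> e0; have [n Kn] : exists n, K / e < n%:R.
  by exists (Num.truncn (`|K / e|)).+1; apply: le_lt_trans (ler_norm _) (truncnS_gt _).
exists n; have : (n%:R : R) <= 2 ^+ n by rewrite -natrX ler_nat ltnW// ltn_expl.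
rewrite expr_div_n expr1n mulrA mulr1 => n2.
rewrite ler_pdivrMr ?exprn_gt0// mulrC -ler_pdivrMr//.
exact: le_trans (ltW Kn) n2.
Qed.

Lemma eq_of_geometric_bound (z w : R[i]) (K : R) :
  (forall n, modulus (z - w) <= K * (1 / 2) ^+ n) -> z = w.
Proof.
move=> zw; apply/eqP; rewrite -subr_eq0 -modulus_eq0; apply: contraT => zw0.
have : 0 < modulus (z - w) by rewrite lt0r zw0 modulus_ge0.
set e := modulus _ in zw * => e0.
have e2 : 0 < e / 2 by lra.
have [n] := geometric_small K e2.
by have := zw n; lra.
Qed.

End Limits.

(** * Bounded maps between l^p spaces *)

Section BoundedMaps.
Variables (R : realType) (p : \bar R).
Hypothesis p_ge1 : (1 <= p)%E.
Local Notation lple := (lple p).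

Definition bounded_map (X Y : choiceType) (T : (X -> R[i]) -> Y -> R[i]) : Prop :=
  exists2 C, 0 <= C & forall f K, lple f K -> lple (T f) (C * K).

Lemma bounded_map_lp (X Y : choiceType) (T : (X -> R[i]) -> Y -> R[i]) f :
  bounded_map T -> lp p f -> lp p (T f).
Proof. by move=> [C _ TC] /lp_lple[K /TC fK]; apply/lp_lple; eexists; exact: fK. Qed.

Lemma bounded_map_comp (X Y Z : choiceType) (T : (X -> R[i]) -> Y -> R[i])
    (U : (Y -> R[i]) -> Z -> R[i]) :
  bounded_map T -> bounded_map U -> bounded_map (fun f => U (T f)).
Proof.
move=> [C C0 TC] [D D0 UD]; exists (D * C); first exact: mulr_ge0.
by move=> f K /TC /UD; rewrite mulrA.
Qed.

Lemma bounded_map_id (X : choiceType) : bounded_map (fun f : X -> R[i] => f).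
Proof. by exists 1 => // f K; rewrite mul1r. Qed.

Lemma bounded_mapD (X Y : choiceType) (T U : (X -> R[i]) -> Y -> R[i]) :
  bounded_map T -> bounded_map U -> bounded_map (fun f y => T f y + U f y).
Proof.
move=> [C C0 TC] [D D0 UD]; exists (4 * (C + D)); first by lra.
move=> f K fK; have := lpleD p_ge1 (TC _ _ fK) (UD _ _ fK).
by have -> : 4 * (C * K + D * K) = 4 * (C + D) * K by ring.
Qed.

Lemma bounded_mapZ (X Y : choiceType) (a : R[i]) (T : (X -> R[i]) -> Y -> R[i]) :
  bounded_map T -> bounded_map (fun f y => a * T f y).
Proof.
move=> [C C0 TC]; exists (modulus a * C); first by rewrite mulr_ge0 ?modulus_ge0.
by move=> f K /TC fK; rewrite -mulrA; exact: lpleZ.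
Qed.

Lemma bounded_map_sum (X Y : choiceType) n (T : 'I_n -> (X -> R[i]) -> Y -> R[i]) :
  (forall i, bounded_map (T i)) -> bounded_map (fun f y => \sum_(i < n) T i f y).
Proof.
elim: n T => [|n IHn] T bT.
  exists 0 => // f K _; rewrite mul0r (_ : (fun _ => _) = fun=> 0); first exact: lple0.
  by apply/funext => y; rewrite big_ord0.
rewrite (_ : (fun _ => _) = fun f y => T ord0 f y + \sum_(i < n) T (lift ord0 i) f y).
  by apply: bounded_mapD => //; apply: IHn.
by apply/funext => f; apply/funext => y; rewrite big_ord_recl.
Qed.

Lemma bounded_map_reindex (X Y : choiceType) (phi : Y -> X) (psi : Y -> 'I_3)
    (D : pred Y) : {in D &, injective (fun y => (phi y, psi y))} ->
  bounded_map (fun f y => if y \in D then f (phi y) else 0).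
Proof.
move=> inj; exists 3 => // f K; apply: (lple_reindex p_ge1 inj) => y.
  by move=> ->.
by move/negbTE ->.
Qed.

Lemma bounded_map_reindexT (X Y : choiceType) (phi : Y -> X) (psi : Y -> 'I_3) :
  injective (fun y => (phi y, psi y)) -> bounded_map (fun f y => f (phi y)).
Proof. by move=> inj; apply: (@bounded_map_reindex _ _ phi psi predT) => y z _ _ /inj. Qed.

End BoundedMaps.

(** * Spectral decimation on words *)

Section Words.
Variable R : realType.
Implicit Types (u s f : word -> R[i]) (l b : word).

(** At a boundary corner [flip] is the identity, so the triangle counts as its own neighbour
    there. *)
Definition adjW u l : R[i] := \sum_(i < 3) u (flip (l, i)).1.

Definition blocksum u b : R[i] := \sum_(i < 3) u (consw i b).

(** The corner labelled by the head letter is the outer corner of a triangle in its block, so this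
    is the neighbour outside the block, or [l] itself at the boundary. *)
Definition mate l : word := (flip (l, l 0%N)).1.

Definition opW (lambda : R[i]) u l : R[i] := adjW u l + (lambda - 3) * u l.

Lemma flip_head_snd l : (flip (l, l 0%N)).2 = (mate l) 0%N.
Proof. by rewrite /mate flip_head. Qed.

Lemma mateK : involutive mate.
Proof.
move=> l; rewrite {1}/mate -flip_head_snd /mate.
by rewrite -surjective_pairing flipK.
Qed.

Lemma shift_mate l : shift (mate l) = (flip (shift l, l 0%N)).1.
Proof. by rewrite /mate flip_head. Qed.

(** The two corners other than the head letter lead to the other members of the block. *)
Lemma adjW_block u l :
  adjW u l = blocksum u (shift l) - u l + u (mate l).
Proof.
rewrite /adjW /blocksum (bigD1 (l 0%N))//= [in RHS](bigD1 (l 0%N))//= consw_shift.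
rewrite (eq_bigr (fun i => u (consw i (shift l)))) => [|i il]; last first.
  by rewrite flip_neq// eq_sym.
by rewrite /mate; ring.
Qed.

(** The mates of the members of a block lie one in each of its three neighbouring blocks. *)
Lemma blocksum_mate s b : blocksum (fun l => s (shift (mate l))) b = adjW s b.
Proof. by apply: eq_bigr => i _; rewrite shift_mate. Qed.

Lemma blocksum_shift s b : blocksum (fun l => s (shift l)) b = 3 * s b.
Proof. by rewrite /blocksum (eq_bigr (fun=> s b))// sumr_const card_ord mulr_natl. Qed.

Lemma blocksumD u f b : blocksum (fun l => u l + f l) b = blocksum u b + blocksum f b.
Proof. by rewrite /blocksum big_split. Qed.

Lemma blocksumZ a u b : blocksum (fun l => a * u l) b = a * blocksum u b.
Proof. by rewrite /blocksum big_distrr. Qed.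

(* Spectral decimation: with [s = blocksum u], [c = 4 - lambda] and
   [P u = u \o mate], [opW lambda u = f] reads [P u - c u = f - s \o shift];
   multiplying by [P + c] and summing over blocks eliminates [u]. *)
Definition decim_rhs (lambda : R[i]) f b : R[i] :=
  blocksum (fun l => f (mate l) + (4 - lambda) * f l) b.

Definition decim_lift (lambda : R[i]) f s l : R[i] :=
  ((lambda - 3) * (5 - lambda))^-1 *
  (f (mate l) + (4 - lambda) * f l
   - (s (shift (mate l)) + (4 - lambda) * s (shift l))).

Lemma opW_block lambda u l :
  opW lambda u l = blocksum u (shift l) + u (mate l) - (4 - lambda) * u l.
Proof. by rewrite /opW adjW_block; ring. Qed.

Lemma opW_blocksum lambda u b :
  opW (Rmap lambda) (blocksum u) b = decim_rhs lambda (opW lambda u) b.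
Proof.
rewrite /decim_rhs.
(* As P is an involution, [(P + c)(P - c) = 1 - c^2], which is [(lambda - 3)(5 - lambda)], the
   denominator in [decim_lift]. *)
transitivity (blocksum (fun l => blocksum u (shift (mate l)) +
   ((4 - lambda) * blocksum u (shift l) + (1 - (4 - lambda) ^+ 2) * u l)) b).
  rewrite blocksumD blocksum_mate blocksumD !blocksumZ blocksum_shift.
  by rewrite /opW /Rmap; ring.
by apply: eq_bigr => i _; rewrite !opW_block mateK; ring.
Qed.

Lemma decim_liftE lambda u : lambda != 3 -> lambda != 5 ->
  decim_lift lambda (opW lambda u) (blocksum u) = u.
Proof.
move=> l3 l5; apply/funext => l; rewrite /decim_lift !opW_block mateK.
have l30 : lambda - 3 != 0 by rewrite subr_eq0.
have l50 : 5 - lambda != 0 by rewrite subr_eq0 eq_sym.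
by field; rewrite l30 l50.
Qed.

(** The equation at [Rmap lambda] says that the lift has block sums [s]; given this, the equation at
    [lambda] follows because [mate] is an involution. *)
Lemma opW_decim_lift lambda f s : lambda != 3 -> lambda != 5 ->
  opW (Rmap lambda) s = decim_rhs lambda f ->
  blocksum (decim_lift lambda f s) = s /\ opW lambda (decim_lift lambda f s) = f.
Proof.
move=> l3 l5 sf.
have l30 : lambda - 3 != 0 by rewrite subr_eq0.
have l50 : 5 - lambda != 0 by rewrite subr_eq0 eq_sym.
have us : blocksum (decim_lift lambda f s) = s.
  apply/funext => b; rewrite /decim_lift blocksumZ blocksumD -/(decim_rhs lambda f b) -sf.
  rewrite (_ : (fun l => - _) = (fun l => -1 * (s (shift (mate l)) + (4 - lambda) * s (shift l)))).
    rewrite blocksumZ blocksumD blocksumZ blocksum_mate blocksum_shift /opW /Rmap.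
    by field; rewrite l30 l50.
  by apply/funext => l; rewrite mulN1r.
split=> //; apply/funext => l; rewrite opW_block us /decim_lift mateK.
by field; rewrite l30 l50.
Qed.

Section Regular.
Variable p : \bar R.
Hypothesis p_ge1 : (1 <= p)%E.

(** Invertibility of [opW lambda] on l^p, as an a priori estimate together with surjectivity. It
    ranges over all words and so is unaffected by shifting [omega]. *)
Definition regularW (lambda : R[i]) : Prop :=
  (exists2 M, 0 <= M & forall u K, lp p u ->
      lple p (opW lambda u) K -> lple p u (M * K)) /\
  (forall f, lp p f -> exists2 u, lp p u & opW lambda u = f).

Lemma bounded_adjW : bounded_map p adjW.
Proof.
apply: (bounded_map_sum p_ge1 (T := fun i u l => u (flip (l, i)).1)) => i.
apply: (bounded_map_reindexT p_ge1 (psi := fun l => (flip (l, i)).2)) => l l' [e1 e2].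
have /flip_inj[//] : flip (l, i) = flip (l', i).
by rewrite [LHS]surjective_pairing e1 e2 -surjective_pairing.
Qed.

Lemma bounded_mate : bounded_map p (fun u l => u (mate l)).
Proof.
by apply: (bounded_map_reindexT p_ge1 (psi := fun=> ord0)) => l l' [/(inv_inj mateK)].
Qed.

Lemma bounded_shift : bounded_map p (fun u l => u (shift l)).
Proof.
apply: (bounded_map_reindexT p_ge1 (psi := fun l => l 0%N)) => l l' [e1 e2].
by rewrite -(consw_shift l) -(consw_shift l') e1 e2.
Qed.

Lemma bounded_blocksum : bounded_map p blocksum.
Proof.
apply: (bounded_map_sum p_ge1 (T := fun i u l => u (consw i l))) => i.
by apply: (bounded_map_reindexT p_ge1 (psi := fun=> ord0)) => l l' [/(congr1 shift)].
Qed.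

Lemma regularW_decim lambda : lambda != 3 -> lambda != 5 ->
  regularW (Rmap lambda) -> regularW lambda.
Proof.
move=> l3 l5 [[M M0 belowM] ontoM].
have bG : bounded_map p (fun f l => f (mate l) + (4 - lambda) * f l).
  apply: (bounded_mapD p_ge1 bounded_mate).
  exact: (bounded_mapZ p_ge1 _ (@bounded_map_id _ _ _)).
have bH : bounded_map p (fun s l => s (shift (mate l)) + (4 - lambda) * s (shift l)).
  exact: (bounded_map_comp bounded_shift bG).
have brhs : bounded_map p (decim_rhs lambda).
  exact: (bounded_map_comp bG bounded_blocksum).
have [C C0 GC] := bG; have [D D0 HD] := bH; have [E E0 rhsE] := brhs.
have liftK f s K L : lple p f K -> lple p s L -> lple p (decim_lift lambda f s)
    (modulus ((lambda - 3) * (5 - lambda))^-1 * (4 * (C * K + modulus (-1 : R[i]) * (D * L)))).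
  move=> fK sL; apply: lpleZ => //; apply: lpleD => //; first exact: GC.
  have := lpleZ p_ge1 (-1) (HD _ _ sL).
  by congr lple; apply/funext => l; rewrite mulN1r.
split.
  exists (modulus ((lambda - 3) * (5 - lambda))^-1 *
    (4 * (C + modulus (-1 : R[i]) * (D * (M * E))))).
    by rewrite mulr_ge0 ?modulus_ge0// mulr_ge0// addr_ge0// mulr_ge0 ?modulus_ge0// !mulr_ge0.
  (* The estimate at [Rmap lambda] controls the block sums, from which [decim_lift] recovers [u]. *)
  move=> u K up uK; rewrite -(decim_liftE u l3 l5).
  have sK : lple p (blocksum u) (M * (E * K)).
    apply: belowM; first exact: bounded_map_lp bounded_blocksum up.
    by have := rhsE _ _ uK; congr lple; apply/funext => b; rewrite opW_blocksum.
  by have := liftK _ _ _ _ uK sK; congr lple; ring.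
move=> f fp; have [s sp sf] := ontoM (decim_rhs lambda f) (bounded_map_lp brhs fp).
exists (decim_lift lambda f s); last by have [] := opW_decim_lift l3 l5 sf.
have [/lp_lple[K fK] /lp_lple[L sL]] := (fp, sp).
by apply/lp_lple; eexists; exact: liftK fK sL.
Qed.

End Regular.
End Words.

(** * Neumann series for large parameters *)

Section Neumann.
Variables (R : realType) (p : \bar R).
Hypothesis p_ge1 : (1 <= p)%E.
Implicit Types u f : word -> R[i].

Lemma adjWB u f l : adjW (fun x => u x - f x) l = adjW u l - adjW f l.
Proof. by rewrite /adjW big_split sumrN. Qed.

Lemma modulus_adjW u (K : R) l : (forall x, modulus (u x) <= K) ->
  modulus (adjW u l) <= 3 * K.
Proof.
move=> uK; apply: le_trans (modulus_sum _ _ _) _.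
apply: le_trans (ler_sum _ (fun i _ => uK (flip (l, i)).1)) _.
by rewrite sumr_const card_ord -[X in X <= _]mulr_natl.
Qed.

Lemma regularW_far : exists B : R, forall lambda, B <= modulus (lambda - 3) ->
  regularW p lambda.
Proof.
have [C C0 AC] := bounded_adjW p_ge1.
(* The term [4 C] absorbs the constant of [lpleD], and 6 makes the Neumann step, of sup norm at most
   [3 / |nu|], contract by 1/2. *)
exists (4 * C + 6) => lambda; set nu := lambda - 3 => Bnu.
have nu_gt0 : 0 < modulus nu by lra.
have nu0 : nu != 0 by rewrite -modulus_gt0.
split.
  exists 4 => // u K up uK.
  have [L uL eL] := lple_exact p_ge1 up (fun=> ord0).
  suff LK : L <= 4 * K by exact: lpleW LK uL.
  (* Solving for [u] bounds its exact norm [L] by itself and [K]; the coefficient of [L] is small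
     enough to be absorbed. *)
  have : lple p u (modulus nu^-1 * (4 * (K + modulus (-1 : R[i]) * (C * L)))).
    have -> : u = fun l => nu^-1 * (opW lambda u l + -1 * adjW u l).
      by apply/funext => l; rewrite /opW -/nu; field.
    by apply: lpleZ => //; apply: lpleD => //; apply: lpleZ => //; exact: AC.
  rewrite modulusV modulusN modulus1 mul1r => -[_]; rewrite eL lee_fin mulrC ler_pdivlMr//.
  have L0 : 0 <= L by case: uL.
  have : L * (4 * C + 6) <= L * modulus nu by exact: ler_wpM2l.
  have K0 : 0 <= K by case: uK.
  by move: (mulr_ge0 C0 L0); lra.
move=> f /lp_lple[K fK]; have K0 : 0 <= K by case: fK.
(* Neumann iterates for [nu u = f - A u]. *)
pose g := fix g n := if n is n'.+1 then fun l => nu^-1 * (f l + -1 * adjW (g n') l) else fun=> 0.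
have gK n : lple p (g n) K.
  elim: n => [|n IHn] /=; first exact: lpleW (lple0 p_ge1 _).
  have := lpleZ p_ge1 nu^-1 (lpleD p_ge1 fK (lpleZ p_ge1 (-1) (AC _ _ IHn))).
  apply: lpleW; rewrite modulusV modulusN modulus1 mul1r mulrC ler_pdivrMr//.
  have : K * (4 * C + 6) <= K * modulus nu by exact: ler_wpM2l.
  by lra.
have dg n l : modulus (g n.+1 l - g n l) <= K * (1 / 2) ^+ n.
  elim: n l => [|n IHn] l.
    rewrite /= subr0 modulusM modulusV expr0 mulr1 mulrC ler_pdivrMr//.
    rewrite (_ : adjW _ _ = 0) ?mulr0 ?addr0; last by rewrite /adjW big1.
    have : K * 1 <= K * modulus nu by rewrite ler_wpM2l//; lra.
    by have := lple_le p_ge1 l fK; lra.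
  have -> : g n.+2 l - g n.+1 l = - nu^-1 * adjW (fun x => g n.+1 x - g n x) l.
    by rewrite adjWB /=; ring.
  rewrite modulusM modulusN modulusV mulrC ler_pdivrMr//.
  apply: le_trans (modulus_adjW _ IHn) _; rewrite exprS.
  have Kn0 : 0 <= K * (1 / 2) ^+ n by rewrite mulr_ge0// exprn_ge0//; lra.
  have : K * (1 / 2) ^+ n * 6 <= K * (1 / 2) ^+ n * modulus nu by rewrite ler_wpM2l//; lra.
  by lra.
have /choice[h hg] l : exists z, forall n, modulus (z - g n l) <= 4 * K * (1 / 2) ^+ n.
  exact: (@geometric_lim _ (fun n => g n l)).
exists h.
  (* The iterates converge in sup norm only, but their l^p bounds are uniform. *)
  apply/lp_lple; eexists; apply: (lple_uniform_lim p_ge1 gK) => e /geometric_small.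
  by move=> /(_ (4 * K))[n nK]; exists n => x; apply: le_trans (hg x n) nK.
apply/funext => l.
apply: (@eq_of_geometric_bound _ _ _ (12 * K + modulus nu * (4 * K) + modulus nu * K)) => n.
(* The residual of the limit is expressed by its distance to [g n] and by one Neumann step. *)
have -> : opW lambda h l - f l =
    adjW (fun x => h x - g n x) l + nu * (h l - g n l) + - nu * (g n.+1 l - g n l).
  by rewrite adjWB /opW -/nu /=; field.
apply: le_trans (modulusD _ _) _; rewrite [leRHS]mulrDl; apply: lerD; last first.
  by rewrite modulusM modulusN -mulrA ler_wpM2l ?modulus_ge0.
apply: le_trans (modulusD _ _) _; rewrite [leRHS]mulrDl; apply: lerD; last first.
  by rewrite modulusM -mulrA ler_wpM2l ?modulus_ge0.
by apply: le_trans (modulus_adjW _ (fun x => hg x n)) _; lra.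
Qed.

End Neumann.

(** * Orbits of R *)

Section Orbits.
Variable R : realType.
Implicit Types z w : R[i].

(** Outside the disc of radius 5/2 about 5/2 the excess distance grows at least fivefold at each
    step, so an orbit is bounded iff it never leaves this disc. *)
Definition bounded_orbit z : Prop :=
  forall n, modulus (iter n (@Rmap R) z - 5 / 2) <= 5 / 2.

Lemma Rmap_center z : Rmap z - 5 / 2 = 15 / 4 - (z - 5 / 2) ^+ 2.
Proof. by rewrite /Rmap; field. Qed.

Lemma modulus_frac m n : modulus (m%:R / n%:R : R[i]) = m%:R / n%:R.
Proof. by rewrite modulusM modulusV !modulus_natr. Qed.

Lemma Rmap_expands z (d : R) : 0 <= d -> 5 / 2 + d <= modulus (z - 5 / 2) ->
  5 / 2 + 5 * d <= modulus (Rmap z - 5 / 2).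
Proof.
move=> d0; rewrite Rmap_center; set w := z - _ => wd; rewrite modulusB.
have := modulus_leB (w ^+ 2) (15 / 4); rewrite modulusX (modulus_frac 15 4).
have : 0 <= (modulus w - (5 / 2 + d)) * (modulus w + (5 / 2 + d)) by apply: mulr_ge0; lra.
have : 0 <= d ^+ 2 by exact: sqr_ge0.
by rewrite !expr2; lra.
Qed.

Lemma iter_Rmap_expands z (d : R) n : 0 <= d -> 5 / 2 + d <= modulus (z - 5 / 2) ->
  5 / 2 + 5 ^+ n * d <= modulus (iter n (@Rmap R) z - 5 / 2).
Proof.
move=> d0 zd; elim: n => [|n IHn]; first by rewrite expr0 mul1r.
have := Rmap_expands _ IHn; rewrite iterS exprS -mulrA; apply.
by rewrite mulr_ge0// exprn_ge0.
Qed.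

Lemma orbit_escapes z : ~ bounded_orbit z -> forall B : R,
  exists n, B <= modulus (iter n (@Rmap R) z - 5 / 2).
Proof.
move=> /existsNP[m /negP]; rewrite -ltNge => zm B.
pose d := modulus (iter m (@Rmap R) z - 5 / 2) - 5 / 2; have d0 : 0 < d by rewrite /d; lra.
have [n nB] := geometric_small B d0.
exists (n + m)%N; rewrite iterD.
have := @iter_Rmap_expands (iter m (@Rmap R) z) d n (ltW d0).
rewrite {1}/d => /(_ _) nd; apply: le_trans (nd _); last by lra.
have n20 : 0 < 2 ^+ n :> R by rewrite exprn_gt0.
have : 2 ^+ n <= 5 ^+ n :> R by rewrite lerXn2r// ?nnegrE; lra.
rewrite -(ler_pM2r d0); move: nB.
rewrite expr_div_n expr1n mulrA mulr1 ler_pdivrMr// mulrC; lra.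
Qed.

(** An orbit that leaves the disc is unbounded, whereas here the tail is confined and only finitely
    many points precede it. *)
Lemma bounded_orbit_eventually z n : bounded_orbit (iter n (@Rmap R) z) -> bounded_orbit z.
Proof.
move=> zn; apply: contrapT => /orbit_escapes esc.
have [B Bn] : exists B : R, forall m, (m <= n)%N -> modulus (iter m (@Rmap R) z - 5 / 2) <= B.
  elim: (n) => [|k [B Bk]]; first by eexists => m; rewrite leqn0 => /eqP ->.
  exists (Num.max B (modulus (iter k.+1 (@Rmap R) z - 5 / 2))) => m.
  by rewrite leq_eqVlt ltnS le_max => /orP[/eqP ->|/Bk ->//]; rewrite lexx orbT.
have [m mB] := esc (`|B| + 3); have B0 := normr_ge0 B; have BB := ler_norm B.
case: (leqP m n) => [/Bn mn|/ltnW/subnK nm]; first by lra.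
by move: mB; rewrite -nm iterD; have := zn (m - n)%N => {Bn esc}; lra.
Qed.

(** The orbit continues from 5 to the fixed point 0. Escaping orbits therefore avoid the exceptional
    value 5 of the decimation. *)
Lemma bounded_orbit_preim5 z n : iter n (@Rmap R) z = 5 -> bounded_orbit z.
Proof.
move=> zn; apply: (@bounded_orbit_eventually _ n.+1); rewrite iterS zn.
have -> : Rmap (5 : R[i]) = 0 by rewrite /Rmap subrr mulr0.
have R00 k : iter k (@Rmap R) 0 = 0.
  by elim: k => [//|k IHk]; rewrite iterS IHk /Rmap mul0r.
by move=> k; rewrite R00 sub0r modulusN (modulus_frac 5 2).
Qed.

(** The point 6 lies outside the disc with excess 1, so its orbit never returns to 3, which is
    inside. Hence preimages of 3 differ from 6, where the reduction to words fails. *)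
Lemma iter_Rmap6_neq3 n : iter n (@Rmap R) 6 != 3.
Proof.
apply/eqP => n3; have := @iter_Rmap_expands 6 1 n ler01.
have -> : 6 - 5 / 2 = 7 / 2 :> R[i] by field.
rewrite n3 (_ : 3 - 5 / 2 = 1 / 2) ?(modulus_frac 7 2) ?(modulus_frac 1 2); last by field.
have k5 : 1 <= 5 ^+ n :> R by rewrite exprn_ege1//; lra.
by move=> /(_ _); lra.
Qed.

Lemma complex_frac m n : (m%:R / n%:R : R[i]) = Complex (m%:R / n%:R) 0.
Proof. by rewrite -[RHS]/((m%:R / n%:R)%:C)%C fmorph_div !rmorph_nat. Qed.

Lemma Rmap_Complex (x y : R) :
  Rmap (Complex x y) = Complex (x * (5 - x) + y ^+ 2) ((5 - 2 * x) * y).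
Proof.
have -> : Rmap (Complex x y) = Complex x y * (5 / 1 - Complex x y) by rewrite divr1.
rewrite (complex_frac 5 1) divr1; apply/eqP; rewrite eq_complex /=.
by apply/andP; split; apply/eqP; ring.
Qed.

(* Both [z] and [Rmap z] lie in the disc of radius [5/2] around [5/2]; with
   [x + i y = z - 5/2] this forces [x^2 >= 5/4 + y^2], while the imaginary part
   is multiplied by [- 2 x]. *)
Lemma bounded_orbit_expands_Im z : bounded_orbit z ->
  2 * (complex.Im z) ^+ 2 <= (complex.Im (Rmap z)) ^+ 2.
Proof.
case: z => x y /(_ 1%N) bz.
have {bz} := le_trans (normRe_le_modulus (Rmap (Complex x y) - 5 / 2)) bz.
rewrite Rmap_Complex (complex_frac 5 2) raddfB /= ler_norml => /andP[_ xy].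
rewrite exprMn ler_wpM2r ?sqr_ge0//.
have := sqr_ge0 y; have -> : (5 - 2 * x) ^+ 2 = 25 - 4 * (x * (5 - x)) by ring.
lra.
Qed.

Lemma bounded_orbit_Rmap z : bounded_orbit z -> bounded_orbit (Rmap z).
Proof. by move=> bz n; rewrite -iterSr. Qed.

(** The squared imaginary part at least doubles at each step, yet stays below 25/4. *)
Lemma bounded_orbit_real z : bounded_orbit z -> complex.Im z = 0.
Proof.
move=> bz; apply/eqP; rewrite -sqrf_eq0; apply: contraT => y0.
have {}y0 : 0 < complex.Im z ^+ 2 by rewrite lt0r y0 sqr_ge0.
have Im_le w : bounded_orbit w -> complex.Im w ^+ 2 <= 25 / 4.
  move=> /(_ 0%N) /= ; move/(le_trans (normIm_le_modulus _)).
  rewrite (complex_frac 5 2) raddfB /= subr0 ler_norml => /andP[? ?].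
  have : 0 <= (5 / 2 - complex.Im w) * (5 / 2 + complex.Im w) by apply: mulr_ge0; lra.
  by rewrite expr2; lra.
have grow n : bounded_orbit (iter n (@Rmap R) z) /\
    complex.Im z ^+ 2 <= complex.Im (iter n (@Rmap R) z) ^+ 2 * (1 / 2) ^+ n.
  elim: n => [|n [bn IHn]]; first by rewrite mulr1.
  split; first exact: bounded_orbit_Rmap.
  apply: le_trans IHn _; rewrite [(1 / 2) ^+ _.+1]exprS mulrA.
  apply: ler_wpM2r; first by rewrite exprn_ge0//; lra.
  by have := bounded_orbit_expands_Im bn; rewrite iterS; lra.
have [n] := geometric_small (25 / 2 : R) y0.
have [/Im_le In zn] := grow n.
have : complex.Im (iter n (@Rmap R) z) ^+ 2 * (1 / 2) ^+ n <= 25 / 4 * (1 / 2) ^+ n.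
  by apply: ler_wpM2r => //; rewrite exprn_ge0//; lra.
by lra.
Qed.

(* In the coordinate [w = z - 5/2] the map is [w |-> 15/4 - w^2] and an orbit in
   [-5/2, 5/2] satisfies [|w| >= sqrt 5 / 2]; the inverse branch through [w]
   therefore contracts. *)
Lemma inverse_branch (w v : R) : `|15 / 4 - w ^+ 2| <= 5 / 2 -> `|v| <= 5 / 2 ->
  exists w' : R, [/\ 15 / 4 - w' ^+ 2 = v, `|w'| <= 5 / 2 &
    `|w' - w| <= `|v - (15 / 4 - w ^+ 2)| / 2].
Proof.
move=> wr vr.
wlog w0 : w wr / 0 <= w.
  move=> hw; have [w0|/ltW w0] := leP 0 w; first exact: hw.
  have [||w' [vw' w'r w'w]] := hw (- w); rewrite ?sqrrN ?oppr_ge0//.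
  exists (- w'); rewrite sqrrN normrN; split=> //.
  by rewrite -normrN opprD !opprK; rewrite sqrrN opprK in w'w.
have v0 : 0 <= 15 / 4 - v by move: vr; rewrite ler_norml => /andP[]; lra.
exists (Num.sqrt (15 / 4 - v)); have s0 := sqrtr_ge0 (15 / 4 - v).
have := sqr_sqrtr v0; set s := Num.sqrt _ in s0 * => ss.
move: vr wr; rewrite !ler_norml !expr2 => /andP[vr1 vr2] /andP[wr1 wr2].
have s1 : 1 <= s.
  rewrite leNgt; apply/negP => s1.
  have : s * s <= 1 * 1 by rewrite ler_pM// ltW.
  by lra.
have w1 : 1 <= w.
  rewrite leNgt; apply/negP => w1.
  have : w * w <= 1 * 1 by rewrite ler_pM// ltW.
  by lra.
split; first by rewrite -expr2; lra.
  apply/andP; split; first by lra.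
  rewrite leNgt; apply/negP => s2.
  have : 0 < (s - 5 / 2) * (s + 5 / 2) by apply: mulr_gt0; lra.
  by lra.
have -> : v - (15 / 4 - w * w) = - ((s - w) * (s + w)).
  by have -> : v = 15 / 4 - s ^+ 2 by [lra]; ring.
rewrite normrN normrM (ger0_norm (_ : 0 <= s + w)); last lra.
have : `|s - w| * 2 <= `|s - w| * (s + w) by apply: ler_wpM2l => //; lra.
by rewrite -ler_norml; lra.
Qed.

(** Pulls 3 back along the inverse branches that follow the real orbit of [z]; each branch halves
    the distance, which is at most 5 at the start. *)
Lemma preimages_of_3_approach z (e : R) : bounded_orbit z -> 0 < e ->
  exists z', modulus (z' - z) <= e /\ exists n, iter n (@Rmap R) z' = 3.
Proof.
move=> bz e0; have [n ne] := geometric_small (5 : R) e0.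
suff [w [_ wz wn]] : exists w : R, [/\ `|w| <= 5 / 2,
    `|w - (complex.Re z - 5 / 2)| <= 5 * (1 / 2) ^+ n &
    iter n (@Rmap R) (Complex (5 / 2 + w) 0) = 3].
  exists (Complex (5 / 2 + w) 0); split; last by exists n.
  have := bounded_orbit_real bz; case: z {bz} wz => x y /= wz ->.
  rewrite subrr expr0n addr0 sqrtr_sqr; apply: le_trans ne.
  by have -> : 5 / 2 + w - x = w - (x - 5 / 2) by ring.
elim: n {e e0 ne} z bz => [|n IHn] z bz.
  (* This is the point 3 in the coordinate centred at 5/2. *)
  exists (1 / 2); split.
  - by rewrite ger0_norm; lra.
  - have := le_trans (normRe_le_modulus _) (bz 0%N).
    rewrite (complex_frac 5 2) raddfB /= ler_norml => /andP[? ?].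
    by rewrite ler_norml; apply/andP; split; lra.
  - have -> : (3 : R[i]) = 3 / 1 by rewrite divr1.
    by rewrite (complex_frac 3 1) /=; congr Complex; field.
have [v [v5 vz vn]] := IHn _ (bounded_orbit_Rmap bz).
have rz : complex.Re (Rmap z) - 5 / 2 = 15 / 4 - (complex.Re z - 5 / 2) ^+ 2.
  have := bounded_orbit_real bz; case: z {bz vz} => x y y0.
  by rewrite (y0 : y = 0) Rmap_Complex /=; field.
have [||w [wv w5 wz]] := @inverse_branch (complex.Re z - 5 / 2) v => //.
  rewrite -rz; have := le_trans (normRe_le_modulus (Rmap z - 5 / 2)) (bz 1%N).
  by rewrite (complex_frac 5 2) raddfB.
exists w; split=> //.
  by apply: le_trans wz _; rewrite -rz exprS; lra.
rewrite iterSr Rmap_Complex -vn -wv; congr iter; congr Complex; first by field.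
by rewrite mulr0.
Qed.

End Orbits.

(** * The Julia set *)

Section JuliaSet.
Variable R : realType.
Implicit Types (z w : R[i]) (P Q : sphere R).

Let height z : R := Num.sqrt (1 + modulus z ^+ 2).

Lemma height_ge1 z : 1 <= height z.
Proof. by rewrite -[1]sqrtr1 ler_wsqrtr// lerDl sqr_ge0. Qed.

Lemma modulus_le_height z : modulus z <= height z.
Proof.
rewrite -[leLHS]ger0_norm ?modulus_ge0// -sqrtr_sqr ler_wsqrtr//.
by rewrite lerDr.
Qed.

Lemma height_le z : height z <= 1 + modulus z.
Proof.
rewrite -[leRHS]ger0_norm ?addr_ge0 ?modulus_ge0// -sqrtr_sqr ler_wsqrtr//.
by have := modulus_ge0 z; rewrite !expr2; nra.
Qed.

Lemma chordalE z w : chordal (Some z) (Some w) = 2 * modulus (z - w) / (height z * height w).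
Proof. by []. Qed.

Lemma chordal_le z w : chordal (Some z) (Some w) <= 2 * modulus (z - w).
Proof.
rewrite chordalE; have hz := height_ge1 z; have hw := height_ge1 w.
have h1 : 1 <= height z * height w by nra.
have h0 : 0 < height z * height w by lra.
rewrite ler_pdivrMr//; have := modulus_ge0 (z - w); nra.
Qed.

Lemma chordal_NoneC z : chordal (Some z) None = 2 / height z.
Proof. by []. Qed.

Lemma chordal_le_heights z w : chordal (Some z) (Some w) <= 2 / height z + 2 / height w.
Proof.
have hz := height_ge1 z; have hw := height_ge1 w.
have h0 : 0 < height z * height w by rewrite mulr_gt0//; lra.
have -> : 2 / height z + 2 / height w = (2 * height w + 2 * height z) / (height z * height w).
  by field; apply/andP; split; rewrite gt_eqF//; lra.
rewrite chordalE ler_pM2r ?invr_gt0//.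
have := modulusD z (- w); rewrite modulusN.
by have := modulus_le_height z; have := modulus_le_height w; lra.
Qed.

Lemma chordal_lt_modulus z (e : R) : 0 < e -> exists2 d : R, 0 < d &
  forall Q, chordal (Some z) Q < d -> exists2 w, Q = Some w & modulus (z - w) < e.
Proof.
move=> e0; have hz := height_ge1 z; have mz := modulus_ge0 z.
(* The first bound excludes infinity and forces [|z - w| < 1 + |z|], hence [height w < 2 (1 + |z|)];
   the second then gives [|z - w| < e]. *)
exists (Num.min (height z)^-1 (e / (height z * (1 + modulus z)))).
  rewrite lt_min invr_gt0 divr_gt0//; first by rewrite andbT; lra.
  by rewrite mulr_gt0//; lra.
move=> [w|]; rewrite lt_min => /andP[]; last first.
  by rewrite chordal_NoneC -[X in _ < X]mul1r ltr_pM2r ?invr_gt0//; lra.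
have hw := height_ge1 w; rewrite chordalE => d1 d2; exists w => //.
have h0 : 0 < height z * height w by rewrite mulr_gt0//; lra.
have hw_le : height w <= 1 + modulus z + modulus (z - w).
  by apply: le_trans (height_le w) _; have := modulus_leB w z; rewrite (modulusB w); lra.
move: d1 d2; rewrite !ltr_pdivrMr// mulrA mulVf ?gt_eqF//; last lra.
rewrite mul1r => d1; set X := modulus (z - w) in d1 hw_le *.
have -> : e / (height z * (1 + modulus z)) * (height z * height w) =
    e * (height w / (1 + modulus z)).
  by field; apply/andP; split; rewrite gt_eqF//; lra.
rewrite mulrA ltr_pdivlMr; last lra.
move=> d2.
have X0 : 0 <= X by exact: modulus_ge0.
have Xz : X < 1 + modulus z by lra.
rewrite ltNge; apply/negP => eX.
have : e * height w <= X * height w by apply: ler_wpM2r; lra.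
have : X * height w <= X * (1 + modulus z + X) by apply: ler_wpM2l.
have : X * X <= X * (1 + modulus z) by apply: ler_wpM2l => //; lra.
by lra.
Qed.

Lemma Rsphere_continuous P (e : R) : 0 < e -> exists2 d : R, 0 < d &
  forall Q, chordal P Q < d -> chordal (Rsphere P) (Rsphere Q) < e.
Proof.
move=> e0; case: P => [z|].
  have mz := modulus_ge0 z.
  have [|d d0 dz] := @chordal_lt_modulus z (Num.min 1 (e / (2 * (6 + 2 * modulus z)))).
    by rewrite lt_min ltr01 divr_gt0//; lra.
  exists d => // Q /dz[w ->]; rewrite lt_min => /andP[zw1 zw2].
  apply: le_lt_trans (chordal_le _ _) _.
  have -> : Rmap z - Rmap w = (z - w) * (5 / 1 - (z + w)) by rewrite /Rmap; field.
  rewrite modulusM.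
  have zw : modulus (5 / 1 - (z + w)) <= 6 + 2 * modulus z.
    apply: le_trans (modulusD _ _) _; rewrite modulusN (modulus_frac R 5 1).
    have := modulusD z w; have := modulus_leB w z; rewrite (modulusB w z); lra.
  move: zw2; rewrite ltr_pdivlMr; last lra.
  by have := ler_wpM2l (modulus_ge0 (z - w)) zw; lra.
(* The radius 1/4 forces [|w| > 7], so that [|Rmap w| >= |w|]; then [height w] is at most twice
   [height (Rmap w)]. *)
exists (Num.min (1 / 4) (e / 4)); first by rewrite lt_min !divr_gt0.
move=> [w|]; rewrite /Rsphere /= ?e0//.
rewrite -/(height w) -/(height (Rmap w)) lt_min.
have hw := height_ge1 w; have hRw := height_ge1 (Rmap w).
rewrite !ltr_pdivrMr; try lra; move=> /andP[w8 we].
have h1 := height_le w; have h2 := modulus_le_height (Rmap w).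
have h3 : modulus w <= modulus (Rmap w).
  have := modulus_leB w (5 / 1); rewrite (modulus_frac R 5 1) divr1 modulusM (modulusB 5) => w5.
  by have := modulus_ge0 w; nra.
have : height w <= 2 * height (Rmap w) by lra.
by nra.
Qed.

Lemma iter_Rsphere n z : iter n (@Rsphere R) (Some z) = Some (iter n (@Rmap R) z).
Proof. by elim: n => //= n ->. Qed.

Lemma iter_Rsphere_None n : iter n (@Rsphere R) None = None.
Proof. by elim: n => //= n ->. Qed.

Lemma iter_Rsphere_continuous n P (e : R) : 0 < e -> exists2 d : R, 0 < d &
  forall k Q, (k <= n)%N -> chordal P Q < d ->
    chordal (iter k (@Rsphere R) P) (iter k (@Rsphere R) Q) < e.
Proof.
elim: n e => [|n IHn] e e0.
  by exists e => // k Q; rewrite leqn0 => /eqP ->.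
have [d d0 dP] := Rsphere_continuous (iter n (@Rsphere R) P) e0.
have [d1 d10 d1P] := IHn _ d0; have [d2 d20 d2P] := IHn _ e0.
exists (Num.min d1 d2) => [|k Q]; first by rewrite lt_min d10.
rewrite leq_eqVlt lt_min => /orP[/eqP->|kn] /andP[Q1 Q2]; last exact: d2P.
by rewrite !iterS; apply: dP; exact: d1P.
Qed.

(** Neighbourhoods of infinity, forward invariant once [5 / 2 <= B]. *)
Definition far (B : R) Q : Prop := if Q is Some z then B <= modulus (z - 5 / 2) else True.

Lemma far_iter (B : R) n Q : 5 / 2 <= B -> far B Q -> far B (iter n (@Rsphere R) Q).
Proof.
move=> B52; case: Q => [z|]; last by rewrite iter_Rsphere_None.
rewrite iter_Rsphere /far => Bz.
have B520 : 0 <= B - 5 / 2 by lra.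
have := iter_Rmap_expands n B520 (_ : 5 / 2 + (B - 5 / 2) <= modulus (z - 5 / 2)).
rewrite (addrC (5 / 2)) subrK => /(_ Bz).
have k5 : 1 <= 5 ^+ n :> R by rewrite exprn_ege1//; lra.
have := ler_wpM2r B520 k5; lra.
Qed.

Lemma far_chordal (e : R) : 0 < e -> exists2 B : R, 5 / 2 <= B &
  forall P Q, far B P -> far B Q -> chordal P Q < e.
Proof.
move=> e0; exists (5 / 2 + 5 / e) => [|P Q]; first by rewrite lerDl divr_ge0// ltW.
have far_height z : 5 / 2 + 5 / e <= modulus (z - 5 / 2) -> 2 / height z < e / 2.
  move=> zB; have := modulus_leB (z - 5 / 2) (- (5 / 2)); rewrite opprK subrK.
  rewrite modulusN (modulus_frac R 5 2) => ze.
  have hz := height_ge1 z; have := modulus_le_height z.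
  have : 5 / e <= modulus z.
    by have := modulusD z (- (5 / 2)); rewrite modulusN (modulus_frac R 5 2); lra.
  rewrite ler_pdivrMr// ltr_pdivrMr; last lra.
  by move=> h1 h2; have := ler_wpM2r (ltW e0) h2; lra.
case: P Q => [z|] [w|] //= => [/far_height zB /far_height wB|/far_height zB _|_ /far_height wB].
- by apply: le_lt_trans (chordal_le_heights z w) _; lra.
- by rewrite -/(height z); lra.
- by rewrite -/(height w); lra.
Qed.

Lemma escaping_far P (B : R) : ~ (Some @` @bounded_orbit R) P ->
  exists n, exists2 d : R, 0 < d & forall Q, chordal P Q < d -> far B (iter n (@Rsphere R) Q).
Proof.
case: P => [z Pz|_].
  have /orbit_escapes esc : ~ bounded_orbit z by move=> bz; apply: Pz; exists z.
  have [n nB] := esc (B + 1); exists n.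
  have [d0 d00 d0P] := chordal_lt_modulus (iter n (@Rmap R) z) ltr01.
  have [d dd0 dP] := iter_Rsphere_continuous n (Some z) d00.
  exists d => // Q /(dP _ _ (leqnn n)); rewrite iter_Rsphere => /d0P[w -> zw].
  by have := modulusD (iter n (@Rmap R) z - w) (w - 5 / 2); rewrite addrA subrK /far; lra.
have B0 := normr_ge0 B; have BB := ler_norm B.
exists 0%N, (2 / (1 + `|B| + 5 / 2)) => [|[w|]//=]; first by rewrite divr_gt0//; lra.
rewrite -/(height w); have := height_ge1 w; have := height_le w => h1 h2.
rewrite ltr_pdivrMr; last lra.
rewrite mulrAC ltr_pdivlMr; last lra.
have := modulusD (w - 5 / 2) (5 / 2); rewrite subrK (modulus_frac R 5 2); lra.
Qed.

(** Bounded orbits are real, so an arbitrarily small vertical displacement of [z] escapes. When it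
    has modulus at least 11, the orbit of [z] is still within modulus 5, and the chordal distance is
    at least 1/12. *)
Lemma bounded_orbit_not_Fatou z : bounded_orbit z ->
  ~ equicontinuous_iterates (@Rsphere R) (Some z).
Proof.
move=> bz /(_ (1 / 12))[|d d0 eqc]; first by rewrite divr_gt0.
pose w := z + Complex 0 (d / 4).
have w_escapes : ~ bounded_orbit w.
  move=> /bounded_orbit_real; rewrite /w raddfD /= (bounded_orbit_real bz); lra.
have zw : chordal (Some z) (Some w) < d.
  apply: le_lt_trans (chordal_le _ _) _.
  rewrite /w opprD addrA subrr add0r modulusN /= expr0n add0r sqrtr_sqr ger0_norm; lra.
have [n nw] := orbit_escapes w_escapes 14.
have := eqc _ zw n; rewrite !iter_Rsphere chordalE.
have := bz n; move: (iter n (@Rmap R) z) (iter n (@Rmap R) w) nw => a b b14 a52.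
have a5 : modulus a <= 5.
  by have := modulusD (a - 5 / 2) (5 / 2); rewrite subrK (modulus_frac R 5 2); lra.
have b11 : 11 <= modulus b.
  by have := modulusD b (- (5 / 2)); rewrite modulusN (modulus_frac R 5 2); lra.
have := height_le a; have := height_le b; have := height_ge1 a; have := height_ge1 b.
move=> h1 h2 h3 h4; have h0 : 0 < height a * height b by rewrite mulr_gt0//; lra.
rewrite ltr_pdivrMr//; have := modulus_leB b a; rewrite (modulusB b a) => ab.
have : height a * height b <= 6 * (1 + modulus b) by apply: ler_pM; lra.
lra.
Qed.

Lemma Julia_Rsphere : Julia (@Rsphere R) = Some @` @bounded_orbit R.
Proof.
rewrite /Julia; apply/seteqP; split=> P; last first.
  move=> [z bz <-] [U [_ Ueqc]] Uz.
  exact: bounded_orbit_not_Fatou bz (Ueqc _ Uz).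
move=> PJ; apply: contrapT => Pesc; apply: PJ.
exists (~` (Some @` @bounded_orbit R)); last exact: Pesc.
split=> [Q Qesc|Q Qesc e e0].
  (* Since 3 exceeds 5/2, being [far 3] rules out a bounded orbit, so the escaping set is open. *)
  have [n [d d0 dQ]] := escaping_far 3 Qesc; exists d => // Q' /dQ + [z bz Q'z].
  by rewrite -Q'z iter_Rsphere /far; have := bz n; lra.
(* Continuity handles the first [n] iterates; afterwards both orbits stay near infinity. *)
have [B B52 farB] := far_chordal e0.
have [n [d1 d10 d1Q]] := escaping_far B Qesc.
have [d2 d20 d2Q] := iter_Rsphere_continuous n Q e0.
exists (Num.min d1 d2) => [|Q']; first by rewrite lt_min d10.
rewrite lt_min => /andP[QQ'1 QQ'2] k; have [kn|/ltnW/subnK <-] := leqP k n.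
  exact: d2Q.
rewrite !iterD; apply: farB; apply: far_iter => //; apply: d1Q => //.
apply: le_lt_trans d10; case: (Q) => [z|] /=; last exact: lexx.
by rewrite subrr modulus0 mulr0 mul0r.
Qed.

End JuliaSet.

(** * Hexagonal eigenfunctions *)

Section Eigenfunctions.
Variable R : realType.

(* Values, at the corners of the triangles, of the eigenfunction of eigenvalue
   6 that alternates along the hexagon of six triangles surrounding the central
   hole of a level-2 cell. *)
Definition hexagon (t : word) (c : word * 'I_3) : R[i] :=
  if (c.1 0%N != c.1 1%N) && `[< shift (shift c.1) = t >] then
    if c.2 == c.1 0%N then 1 else if c.2 == c.1 1%N then 0 else -1
  else 0.

(** Makes the values well defined at the vertices of the lattice. *)
Lemma hexagon_flip t c : hexagon t (flip c) = hexagon t c.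
Proof.
case: c => l i; have [<-{i}|li] := eqVneq (l 0%N) i.
  rewrite flip_head /hexagon /=; have [l01|l01] := eqVneq (l 0%N) (l 1%N).
    have -> : flip (shift l, l 0%N) = flip (shift l, shift l 0%N) by rewrite l01.
    by rewrite flip_head /= eqxx.
  rewrite (flip_neq (l := shift l) (i := l 0%N)) 1?eq_sym//=.
  by rewrite !eqxx [l 0%N != _]l01.
rewrite flip_neq// /hexagon /= !(eq_sym _ (l 0%N)) (negbTE li).
have -> : shift (shift (consw i (shift l))) = shift (shift l) by [].
rewrite -/(shift l 0%N); have -> : shift l 0%N = l 1%N by [].
by case: (eqVneq i (l 1%N)); case: (eqVneq (l 0%N) (l 1%N)) => //=; case: ifP.
Qed.

Lemma hexagon_sum t l : \sum_(i < 3) hexagon t (l, i) = 0.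
Proof.
rewrite /hexagon /=; case E : (_ && _); last by rewrite big1.
have /andP[l01 _] := E.
rewrite !big_ord_recl big_ord0; move: (l 0%N) (l 1%N) l01.
by move=> [[|[|[|//]]] ?] [[|[|[|//]]] ?]; rewrite -?val_eqE//= => _; ring.
Qed.

Lemma hexagon_consw t (a b : 'I_3) : a != b ->
  hexagon t (consw a (consw b t), a) = 1.
Proof. by move=> ab; rewrite /hexagon /= ab eqxx; case: asboolP. Qed.

Lemma hexagon_supp t (l : word) i : hexagon t (l, i) != 0 ->
  l = consw (l 0%N) (consw (l 1%N) t).
Proof.
rewrite /hexagon; case: ifP; last by rewrite eqxx.
by move=> /andP[_ /asboolP <-] _; apply/funext => -[|[|]].
Qed.

Variable p : \bar R.
Hypothesis p_ge1 : (1 <= p)%E.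

(** Since [u] lives on the triangles of all lattices, it must be nonzero somewhere on the lattice of
    [w]. *)
Definition eigenvalueW (lambda : R[i]) (w : word) : Prop :=
  exists u, [/\ lp p u, opW lambda u = (fun=> 0) &
                exists2 l, tail_eq l w & u l != 0].

(** The hexagon function is read at the outer corner of each triangle. Its block sums vanish by
    [hexagon_sum] and it is [mate]-invariant by [hexagon_flip], which is the equation at 3. *)
Lemma eigenvalueW3 w : eigenvalueW 3 w.
Proof.
pose t := shift (shift (shift w)).
exists (fun l => hexagon t (shift l, l 0%N)); split.
- pose s := [seq consw a l | a <- enum 'I_3,
                 l <- [seq consw b (consw c t) | b <- enum 'I_3, c <- enum 'I_3]].
  apply: (lp_fin_supp p_ge1 (s := s)) => l ls; apply/eqP; apply: contraNT ls.
  move=> /hexagon_supp ls; rewrite -(consw_shift l) ls.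
  apply: allpairs_f; first by rewrite mem_enum.
  by apply: allpairs_f; rewrite mem_enum.
- apply/funext => l; rewrite opW_block.
  rewrite [blocksum _ _](hexagon_sum t (shift l)) add0r shift_mate.
  rewrite -flip_head_snd flip_head /= -surjective_pairing hexagon_flip; ring.
- exists (consw ord0 (consw ord0 (consw ord_max t))).
    by exists 3%N => -[|[|[|]]].
  by rewrite hexagon_consw ?oner_eq0.
Qed.

Lemma eigenvalueW_decim (lambda : R[i]) w : lambda != 3 -> lambda != 5 ->
  eigenvalueW (Rmap lambda) (shift w) -> eigenvalueW lambda w.
Proof.
move=> l3 l5 [s [sp s0 [b bw sb]]]; exists (decim_lift lambda (fun=> 0) s).
have rhs0 : opW (Rmap lambda) s = decim_rhs lambda (fun=> 0).
  by rewrite s0; apply/funext => l; rewrite /decim_rhs /blocksum big1// => i _; rewrite mulr0 addr0.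
have [us u0] := opW_decim_lift l3 l5 rhs0; split=> //.
  rewrite (_ : decim_lift _ _ _ = fun l => - ((lambda - 3) * (5 - lambda))^-1 *
    (s (shift (mate l)) + (4 - lambda) * s (shift l))); last first.
    by apply/funext => l; rewrite /decim_lift; ring.
  have bP := bounded_map_comp (bounded_shift p_ge1) (bounded_mapD p_ge1 (bounded_mate p_ge1)
    (bounded_mapZ p_ge1 (4 - lambda) (@bounded_map_id _ p _))).
  exact: (bounded_map_lp (bounded_mapZ p_ge1 _ bP) sp).
(* A lift vanishing on the lattice of [w] would have vanishing block sums, which are the values of
   [s] on the lattice of [shift w]. *)
apply: contrapT => no; case/negP: sb; apply/eqP; rewrite -us.
rewrite /blocksum big1// => i _; apply/eqP; apply: contrapT => /negP ui; apply: no.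
by exists (consw i b) => //; apply/tail_eq_shift.
Qed.

Lemma eigenvalueW_preim3 n (lambda : R[i]) w :
  iter n (@Rmap R) lambda = 3 -> eigenvalueW lambda w.
Proof.
elim: n lambda w => [|n IHn] lambda w; first by move=> /= ->; exact: eigenvalueW3.
have [->|l3] := eqVneq lambda 3; first by move=> _; exact: eigenvalueW3.
(* The orbit of 5 is 5, 0, 0, ... and never meets 3. *)
have [->|l5] := eqVneq lambda 5.
  rewrite iterSr (_ : Rmap 5 = 0); last by rewrite /Rmap subrr mulr0.
  rewrite (_ : iter n _ 0 = 0); last by elim: n {IHn} => //= n ->; rewrite /Rmap mul0r.
  by move/esym/eqP; rewrite pnatr_eq0.
by rewrite iterSr => /IHn H; exact: eigenvalueW_decim.
Qed.

End Eigenfunctions.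

(** * Coordinates of the lattice *)

Section Addresses.
Implicit Types (l : word) (a i : 'I_3).

(* [2^m] times the [a]-th barycentric coordinate of
   [F_(l_(m-1)) ... F_(l_0) q_i] with respect to [q_0, q_1, q_2]. *)
Definition bary a l (m : nat) i : nat :=
  ((i == a) + \sum_(k < m) 2 ^ k * (l k == a))%N.

Lemma baryS a l m i :
  bary a l m.+1 i = ((i == a) + (l 0 == a) + 2 * (\sum_(k < m) 2 ^ k * (shift l k == a)))%N.
Proof.
rewrite /bary big_ord_recl expn0 mul1n addnA; congr addn.
by rewrite big_distrr; apply: eq_bigr => k _; rewrite /= expnS mulnA.
Qed.

Lemma bary_recr a l m i : bary a l m.+1 i = (bary a l m i + 2 ^ m * (l m == a))%N.
Proof. by rewrite /bary big_ord_recr addnA. Qed.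

(** Induction on [m] by parity: all coordinates are even iff [l 0 = i], and otherwise exactly those
    at [i] and [l 0] are odd. In the first case the claim passes to the shifts; in the second,
    [(l' 0, i')] is [(l 0, i)] or [(i, l 0)], and the latter is the flip. *)
Lemma bary_inj m l l' i i' :
  (forall a, bary a l m i = bary a l' m i') -> (forall k, (m <= k)%N -> l k = l' k) ->
  (l', i') = (l, i) \/ (l', i') = flip (l, i).
Proof.
elim: m l l' i i' => [|m IHm] l l' i i' eq_b eq_t.
  left; have -> : l' = l by apply/funext => k; rewrite eq_t.
  have := eq_b i; rewrite /bary !big_ord0 eqxx !addn0.
  by have [->|] := eqVneq i' i.
have eq_t' k : (m <= k)%N -> shift l k = shift l' k by move=> mk; apply: eq_t.
have {}eq_b a := etrans (esym (baryS a l m i)) (etrans (eq_b a) (baryS a l' m i')).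
have [li|li] := eqVneq (l 0%N) i.
  have li' : l' 0%N = i'.
    apply/eqP; move: (eq_b i'); rewrite -li eqxx.
    by case: (l' 0%N == i') => //; case: (l 0%N == i'); lia.
  have /IHm/(_ eq_t') : forall a, bary a (shift l) m i = bary a (shift l') m i'.
    by move=> a; move: (eq_b a); rewrite li li' /bary; lia.
  case=> [[e1 e2]|e].
    by left; rewrite -(consw_shift l') -[in RHS](consw_shift l) li li' e1 e2.
  by right; rewrite -(consw_shift l') li' -(consw_shift l) li flip_cons_eq -e.
(* The induction hypothesis at a common corner; a flip keeping its corner is trivial. *)
have tails : (forall a, \sum_(k < m) 2 ^ k * (shift l k == a) =
    \sum_(k < m) 2 ^ k * (shift l' k == a))%N -> shift l' = shift l.
  move=> eq_s; have /IHm/(_ eq_t') : forall a, bary a (shift l) m i = bary a (shift l') m i.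
    by move=> a; rewrite /bary eq_s.
  by case=> [[]|e]//; have := flip_snd_fixed (congr1 snd (esym e)); rewrite -e => -[].
have li' : l' 0%N != i'.
  apply/eqP => li'; move: (eq_b i); rewrite li' eqxx (negbTE li).
  by case: (i' == i); lia.
have [ii'|ii'] := eqVneq i' i.
  have l0 : l' 0%N = l 0%N.
    apply/eqP; move: (eq_b (l 0%N)); rewrite ii' eqxx (eq_sym i) (negbTE li).
    by case: (l' 0%N == l 0%N) => //; lia.
  left; rewrite ii' -(consw_shift l') l0 tails ?consw_shift// => a.
  by move: (eq_b a); rewrite ii' l0; lia.
have l0 : l' 0%N = i.
  apply/eqP; move: (eq_b i); rewrite eqxx (negbTE li) (negbTE ii').
  by case: (l' 0%N == i) => //; lia.
have i'l : i' = l 0%N.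
  apply/eqP; move: (eq_b (l 0%N)); rewrite eqxx l0 (eq_sym i) (negbTE li).
  by case: (i' == l 0%N) => //; lia.
right; rewrite (flip_neq li) -(consw_shift l') l0 i'l tails// => a.
by move: (eq_b a); rewrite i'l l0; lia.
Qed.

End Addresses.

(** * Addresses and adjacency of lattice points in the plane *)

Section Geometry.
Variable R : realType.
Implicit Types (l w : word) (i j : 'I_3) (y : R * R).

(** The first letter acts first, so that along [omega] this undoes the blow-up. *)
Fixpoint zoom w (m : nat) y : R * R :=
  if m is m'.+1 then F (w m') (zoom w m' y) else y.

Lemma eq_zoom l w m : (forall k, (k < m)%N -> l k = w k) -> zoom l m = zoom w m.
Proof.
elim: m => [//|m IHm] lw; apply/funext => y /=; rewrite lw// IHm// => k km.
by apply: lw; apply: ltnW.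
Qed.

Lemma F_bij i : bijective (@F R i).
Proof.
exists (fun y => (2 * (y.1 - (trans R i).1), 2 * (y.2 - (trans R i).2))) => -[y1 y2];
  by rewrite /F /=; congr pair; field.
Qed.

Lemma zoom_bij w m : bijective (zoom w m).
Proof. by elim: m => [|m IHm]; [exists id|apply: (bij_comp (F_bij (w m)) IHm)]. Qed.

Lemma trans_q i : trans R i = (1 / 2 * (q R i).1, 1 / 2 * (q R i).2).
Proof. by case: i => -[|[|[|//]]] ?; rewrite /trans /q /=; congr pair; field. Qed.

Lemma F_q i j : F i (q R j) = F j (q R i).
Proof. by rewrite /F !trans_q /= ![1 / 2 * (q R i).1 + _]addrC ![1 / 2 * (q R i).2 + _]addrC. Qed.

Lemma F_qq i : F i (q R i) = q R i.
Proof. by rewrite /F !trans_q /= [RHS]surjective_pairing; congr pair; field. Qed.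

Lemma zoom_const l m i : (forall k, (k < m)%N -> l k = i) -> zoom l m (q R i) = q R i.
Proof.
elim: m => [//|m IHm] li /=; rewrite li// IHm ?F_qq// => k km.
by apply: li; apply: ltnW.
Qed.

Lemma zoom_bary l m i :
  2 ^+ m * (zoom l m (q R i)).1 = (bary ord0 l m i)%:R / 2 + (bary ord_max l m i)%:R /\
  2 ^+ m * (zoom l m (q R i)).2 = Num.sqrt 3 / 2 * (bary ord0 l m i)%:R.
Proof.
have q1 j : (q R j).1 = (j == ord0)%:R / 2 + (j == ord_max)%:R.
  by case: j => -[|[|[|//]]] ?; rewrite /q -!val_eqE /=; field.
have q2 j : (q R j).2 = Num.sqrt 3 / 2 * (j == ord0)%:R.
  by case: j => -[|[|[|//]]] ?; rewrite /q -!val_eqE /=; field.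
elim: m => [|m [IH1 IH2]].
  by rewrite /bary !big_ord0 !addn0 q1 q2 expr0 !mul1r.
rewrite /= trans_q /= exprS q1 q2 !bary_recr.
rewrite !(natrD _ (bary _ _ _ _)) !natrM !natrX.
split; [move: IH1|move: IH2]; set z := zoom _ _ _ => IH.
  have -> : 2 * 2 ^+ m * (1 / 2 * z.1 + 1 / 2 * ((l m == ord0)%:R / 2 + (l m == ord_max)%:R)) =
    2 ^+ m * z.1 + 2 ^+ m * ((l m == ord0)%:R / 2 + (l m == ord_max)%:R) by field.
  by rewrite IH; field.
have -> : 2 * 2 ^+ m * (1 / 2 * z.2 + 1 / 2 * (Num.sqrt 3 / 2 * (l m == ord0)%:R)) =
  2 ^+ m * z.2 + 2 ^+ m * (Num.sqrt 3 / 2 * (l m == ord0)%:R) by field.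
by rewrite IH; field.
Qed.

Lemma bary_sum l m i :
  (bary ord0 l m i + bary (lift ord0 ord0) l m i + bary ord_max l m i = 2 ^ m)%N.
Proof.
have delta j : ((j == ord0) + (j == lift ord0 ord0) + (j == ord_max) = 1)%N.
  by case: j => -[|[|[|//]]].
elim: m => [|m IHm]; first by rewrite /bary !big_ord0 !addn0.
by rewrite !bary_recr expnS; have := delta (l m); nia.
Qed.

(** The second planar coordinate determines the barycentric one at [q_0], the first then the one at
    [q_2], and their total [2^m] the last. *)
Lemma zoom_inj l l' m i i' : zoom l m (q R i) = zoom l' m (q R i') ->
  (forall k, (m <= k)%N -> l k = l' k) -> (l', i') = (l, i) \/ (l', i') = flip (l, i).
Proof.
move=> eq_z; apply: bary_inj => a.
have [b1 b2] := zoom_bary l m i; have [b1' b2'] := zoom_bary l' m i'.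
have s3 : 0 < Num.sqrt 3 :> R by rewrite sqrtr_gt0.
have e0 : bary ord0 l m i = bary ord0 l' m i'.
  apply/eqP; rewrite -(eqr_nat R); apply/eqP.
  have : Num.sqrt 3 / 2 * (bary ord0 l m i)%:R = Num.sqrt 3 / 2 * (bary ord0 l' m i')%:R :> R.
    by rewrite -b2 -b2' eq_z.
  by apply: mulfI; rewrite gt_eqF// divr_gt0.
have e2 : bary ord_max l m i = bary ord_max l' m i'.
  by apply/eqP; rewrite -(eqr_nat R); apply/eqP; move: b1 b1'; rewrite eq_z e0; lra.
have := bary_sum l m i; have := bary_sum l' m i'.
have [->|a0] := eqVneq a ord0; first by [].
have [->|a2] := eqVneq a ord_max; first by [].
have -> : a = lift ord0 ord0 by move: a0 a2; case: a => -[|[|[|//]]] // ? _ _; apply/val_inj.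
by lia.
Qed.

Variable omega : word.

Lemma blowupE m (A : set (R * R)) y : blowup omega m A y <-> A (zoom omega m y).
Proof. by elim: m A => [//|m IHm] A /=; rewrite IHm. Qed.

Lemma V_zoom m y : V m y <-> exists l i, y = zoom l m (q R i).
Proof.
elim: m y => [|m IHm] y.
  split=> [[i _ <-]|[l [i ->]]]; first by exists (fun=> ord0), i.
  by exists i.
split=> [[j _ [_ /IHm[l [i ->]] <-]]|[l [i ->]]].
  exists (fun k => if k == m then j else l k), i; rewrite /= eqxx.
  by congr F; apply/(congr1 (@^~ _))/eq_zoom => k km; rewrite ltn_eqF.
by exists (l m) => //; exists (zoom l m (q R i)) => //; apply/IHm; exists l, i.
Qed.

Lemma cell_zoom (s : seq 'I_3) y : cell s y <->
  exists i, y = zoom (nth ord0 s) (size s) (q R i).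
Proof.
elim/last_ind: s y => [|s j IHs] y.
  by split=> [[i _ <-]|[i ->]]; exists i.
have nth_s : zoom (nth ord0 (rcons s j)) (size s) = zoom (nth ord0 s) (size s).
  by apply: eq_zoom => k ks; rewrite nth_rcons ks.
rewrite /cell -cats1 foldl_cat /= -/(cell s) size_cat addn1 cats1 /= nth_s.
rewrite nth_rcons ltnn eqxx; split=> [[_ /IHs[i ->] <-]|[i ->]]; first by exists i.
by exists (zoom (nth ord0 s) (size s) (q R i)) => //; apply/IHs; exists i.
Qed.

(* [x] is the corner [c.2] of the triangle
   [F_(omega_1)^-1 ... F_(omega_m)^-1 F_(l_m) ... F_(l_1) (V_0)], [l = c.1],
   for all [m] beyond which [l] agrees with [omega]. *)
Definition address (x : @lattice R omega) (c : word * 'I_3) : Prop :=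
  exists m, (forall k, (m <= k)%N -> c.1 k = omega k) /\
    zoom omega m (val x) = zoom c.1 m (q R c.2).

Lemma address_tail x c : address x c -> tail_eq c.1 omega.
Proof. by move=> [m [tm _]]; exists m. Qed.

Lemma address_geq x c : address x c -> exists m, forall n, (m <= n)%N ->
  (forall k, (n <= k)%N -> c.1 k = omega k) /\
  zoom omega n (val x) = zoom c.1 n (q R c.2).
Proof.
move=> [m [tm zm]]; exists m => n mn; split=> [k nk|]; first by apply: tm; apply: leq_trans nk.
rewrite -(subnK mn); elim: (n - m)%N => [//|d IHd].
by rewrite addSn /= IHd tm// leq_addl.
Qed.

Lemma address_exists l i : tail_eq l omega -> exists x, address x (l, i).
Proof.
move=> [m tm]; have [g gK Kg] := zoom_bij omega m.+1.
have lat : @lattice R omega (g (zoom l m.+1 (q R i))).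
  by exists m.+1 => //; apply/blowupE; rewrite Kg; apply/V_zoom; exists l, i.
exists (SigSub (mem_set lat)); exists m.+1; split; last exact: Kg.
by move=> k /ltnW; exact: tm.
Qed.

Lemma exists_address x : exists c, address x c.
Proof.
have [m _ /blowupE/V_zoom[l [i xl]]] := set_valP x.
exists (fun k => if (k < m)%N then l k else omega k, i), m.
split=> [k mk|] /=; first by rewrite ltnNge mk.
by rewrite xl; apply/(congr1 (@^~ _))/eq_zoom => k ->.
Qed.

Lemma address_fun x x' c : address x c -> address x' c -> x = x'.
Proof.
move=> /address_geq[m xm] /address_geq[m' xm'].
have [_ e] := xm _ (leq_maxl m m'); have [_ e'] := xm' _ (leq_maxr m m').
by apply/val_inj/(bij_inj (zoom_bij omega (maxn m m'))); rewrite e e'.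
Qed.

Lemma address_inj x c c' : address x c -> address x c' -> c' = c \/ c' = flip c.
Proof.
case: c c' => l i [l' i'] /address_geq[m xm] /address_geq[m' xm'].
have [t e] := xm _ (leq_maxl m m'); have [t' e'] := xm' _ (leq_maxr m m').
apply: (@zoom_inj _ _ (maxn m m')) => [|k km]; first by rewrite -e -e'.
by rewrite [LHS]t// [RHS]t'.
Qed.

Lemma address_flip x c : address x c -> address x (flip c).
Proof.
case: c => l i /address_geq[m xm].
have [/flip_const->|[k [lt_k lk]]] := flip_cases l i; first by exists m; apply: xm.
pose n := (k.+1 + m)%N; have [t e] := xm n (leq_addl _ _).
have [m' t'] : tail_eq (flip (l, i)).1 omega by apply: flip_tail; exists n.
exists n; split.
  move=> j nj; rewrite (flip_swap lt_k lk) /= /swap_prefix.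
  have kj : (k < j)%N by apply: leq_trans nj; rewrite leq_addr.
  by rewrite ltnNge ltnW//= gtn_eqF// -t.
(* After [k] letters the two codes are still at [q_i] and [q_(l k)]; the next letter identifies them
   because [F_j q_i = F_i q_j], and the later letters agree. *)
rewrite e (flip_swap lt_k lk) /n /=; elim: (m) => [|d IHd].
  have sk : swap_prefix l i k k = i by rewrite /swap_prefix ltnn eqxx.
  have zk : zoom (swap_prefix l i k) k (q R (l k)) = q R (l k).
    by apply: zoom_const => j jk; rewrite /swap_prefix jk.
  by rewrite addn0 /= sk zk (zoom_const lt_k); exact: F_q.
have sk : swap_prefix l i k (k.+1 + d)%N = l (k.+1 + d)%N.
  have kd : (k < k.+1 + d)%N by rewrite ltnS leq_addr.
  by rewrite /swap_prefix ltnNge ltnW//= gtn_eqF.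
by rewrite addnS /= IHd sk.
Qed.

Lemma adj_address (x y : @lattice R omega) : adj x y <->
  x <> y /\ exists l i j, address x (l, i) /\ address y (l, j).
Proof.
split=> [[xy [m [s [_ /blowupE/cell_zoom[i xi] /blowupE/cell_zoom[j yj]]]]]|].
  split=> //; exists (fun k => if (k < m)%N then nth ord0 s k else omega k), i, j.
  split; exists m; (split=> [k mk|] /=; first by rewrite ltnNge mk).
    rewrite xi size_tuple; apply/(congr1 (@^~ _))/eq_zoom => k ->//.
  by rewrite yj size_tuple; apply/(congr1 (@^~ _))/eq_zoom => k ->.
move=> [xy [l [i [j [/address_geq[m xm] /address_geq[m' ym]]]]]]; split=> //.
(* The successor ensures [1 <= n]. *)
pose n := (maxn m m').+1; exists n, [tuple l k | k < n].
have zn z : zoom (nth ord0 [tuple l k | k < n]) (size [tuple l k | k < n]) z = zoom l n z.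
  rewrite size_tuple; apply/(congr1 (@^~ _))/eq_zoom => k kn.
  by rewrite -(tnth_nth _ _ (Ordinal kn)) tnth_mktuple.
split=> //; apply/blowupE/cell_zoom.
  by exists i; rewrite zn; apply: (xm n _).2; rewrite leqW// leq_maxl.
by exists j; rewrite zn; apply: (ym n _).2; rewrite leqW// leq_maxr.
Qed.

End Geometry.

(** * The Laplacian as a sum over triangles *)

Section LatticeOperators.
Variables (R : realType) (omega : word).
Local Notation L := (@lattice R omega).
Implicit Types (x y : L) (c : word * 'I_3) (f : L -> R[i]) (g : word -> R[i]).

(** Extension by zero to the codes of other lattices gives functions on all words. *)
Definition pull f c : R[i] :=
  if pselect (exists x, address x c) is left ex then f (sval (cid ex)) else 0.

Lemma pullE f c x : address x c -> pull f c = f x.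
Proof.
move=> xc; rewrite /pull; case: pselect => [ex|[]]; last by exists x.
by rewrite (address_fun (svalP (cid ex)) xc).
Qed.

Lemma pull_out f c : ~ tail_eq c.1 omega -> pull f c = 0.
Proof.
move=> nc; rewrite /pull; case: pselect => // ex; exfalso; apply: nc.
by case: ex => x; exact: address_tail.
Qed.

Definition rep x : word * 'I_3 := sval (cid (exists_address x)).

Lemma repP x : address x (rep x). Proof. exact: svalP. Qed.

Definition triangle_sum f l : R[i] := \sum_(i < 3) pull f (l, i).

(** The operator T^* dual to [triangle_sum]; at a boundary vertex [flip] fixes the code and the only
    triangle counts twice. *)
Definition vertex_sum g x : R[i] := g (rep x).1 + g (flip (rep x)).1.

Lemma vertex_sumE g x c : address x c -> vertex_sum g x = g c.1 + g (flip c).1.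
Proof.
by move=> xc; case: (address_inj xc (repP x)) => e; rewrite /vertex_sum e ?flipK// addrC.
Qed.

Lemma triangle_sum_out f l : ~ tail_eq l omega -> triangle_sum f l = 0.
Proof. by move=> tl; rewrite /triangle_sum big1// => i _; rewrite pull_out. Qed.

Lemma triangle_sum_vertex_sum g l : tail_eq l omega ->
  triangle_sum (vertex_sum g) l = adjW g l + 3 * g l.
Proof.
move=> tl; rewrite /triangle_sum (eq_bigr (fun i => g l + g (flip (l, i)).1)) => [|i _].
  by rewrite big_split /= sumr_const card_ord mulr_natl addrC.
have [x xl] := @address_exists R omega l i tl.
by rewrite (pullE _ xl) (vertex_sumE _ xl).
Qed.

Lemma eq_vertex_sum g g' x : (forall l, tail_eq l omega -> g l = g' l) ->
  vertex_sum g x = vertex_sum g' x.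
Proof.
move=> gg; rewrite /vertex_sum gg; last exact: address_tail (repP x).
by rewrite gg//; exact: address_tail (address_flip (repP x)).
Qed.

Lemma triangle_sum_linear a f f' l :
  triangle_sum (fun x => a * f x + f' x) l = a * triangle_sum f l + triangle_sum f' l.
Proof.
rewrite /triangle_sum big_distrr -big_split; apply: eq_bigr => i _ /=.
by rewrite /pull; case: pselect => // _; rewrite mulr0 addr0.
Qed.

Lemma vertex_sum_linear a g g' x :
  vertex_sum (fun l => a * g l + g' l) x = a * vertex_sum g x + vertex_sum g' x.
Proof. by rewrite /vertex_sum; ring. Qed.

Let others i : seq 'I_3 := [seq j <- enum 'I_3 | j != i].

Lemma mem_others i j : (j \in others i) = (j != i).
Proof. by rewrite mem_filter mem_enum andbT. Qed.

Lemma size_others i : size (others i) = 2.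
Proof.
rewrite size_filter; have := count_predC (pred1 i) (enum 'I_3).
by rewrite count_uniq_mem ?enum_uniq// mem_enum size_enum_ord => -[].
Qed.

Lemma sum_others i (h : 'I_3 -> R[i]) : h i + \sum_(j <- others i) h j = \sum_j h j.
Proof. by rewrite [RHS](bigD1 i)//= big_filter big_enum_cond. Qed.

Lemma neighbours_address x l i (v v' : 'I_3 -> L) : address x (l, i) ->
  (forall j, address (v j) (l, j)) ->
  (forall j, address (v' j) ((flip (l, i)).1, j)) ->
  neighbours x = [set` map v (others i) ++ map v' (others (flip (l, i)).2)].
Proof.
move=> xl vl v'l; have xl' := address_flip xl.
apply/seteqP; split=> y.
  move=> /adj_address[xy [l1 [i1 [j [xl1 yl1]]]]]; rewrite /= mem_cat.
  case: (address_inj xl xl1) => e; apply/orP; [left|right].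
    case: e => e1 e2; subst l1 i1.
    apply/mapP; exists j; last exact: address_fun yl1 (vl j).
    by rewrite mem_others; apply/eqP => ji; apply: xy; apply: address_fun xl1 _; rewrite -ji.
  rewrite -e in v'l *; apply/mapP; exists j; last exact: address_fun yl1 (v'l j).
  by rewrite mem_others; apply/eqP => /= ji; apply: xy; apply: address_fun xl1 _; rewrite -ji.
rewrite /= mem_cat => /orP[] /mapP[j]; rewrite mem_others => ji ->; apply/adj_address.
  split; last by exists l, i, j.
  move=> xv; have := vl j; rewrite -xv => /(address_inj xl)[[/eqP]|e].
    by rewrite (negbTE ji).
  have := @flip_fst_fixed l i; rewrite -e => /(_ erefl)[/eqP].
  by rewrite (negbTE ji).
split; last first.
  by exists (flip (l, i)).1, (flip (l, i)).2, j; rewrite -surjective_pairing.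
move=> xv; have := v'l j; rewrite -xv => /(address_inj xl')[/(congr1 snd)/= /eqP|e].
  by rewrite (negbTE ji).
have := @flip_fst_fixed (flip (l, i)).1 (flip (l, i)).2.
rewrite -surjective_pairing -e => /(_ erefl)/(congr1 snd)/= /eqP.
by rewrite (negbTE ji).
Qed.

Lemma uniq_corners l (v : 'I_3 -> L) i :
  (forall j, address (v j) (l, j)) -> uniq (map v (others i)).
Proof.
move=> vl; rewrite map_inj_uniq; first by apply: filter_uniq; exact: enum_uniq.
move=> j k vjk.
have := vl k; rewrite -vjk => /(address_inj (vl j))[[]//|e].
by have := @flip_fst_fixed l j; rewrite -e => /(_ erefl)[].
Qed.

Lemma corners_disjoint l i (v v' : 'I_3 -> L) : flip (l, i) <> (l, i) ->
  (forall j, address (v j) (l, j)) ->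
  (forall j, address (v' j) ((flip (l, i)).1, j)) ->
  ~~ has (mem (map v (others i))) (map v' (others (flip (l, i)).2)).
Proof.
move=> fl vl v'l; apply/hasPn => _ /mapP[k _ ->]; apply/negP => /mapP[j].
rewrite mem_others => ji v'v; have := v'l k; rewrite v'v.
move=> /(address_inj (vl j))[[e _]|e].
  by apply: fl; apply: flip_fst_fixed.
have /flip_fst_inj ij : (flip (l, i)).1 = (flip (l, j)).1 by rewrite -e.
by rewrite ij eqxx in ji.
Qed.

Lemma card_set_seq (T : choiceType) (s : seq T) n : uniq s ->
  reflect (size s = n) ([set` s] #= `I_n)%card.
Proof.
move=> us; have -> : [set` s] = [set` [fset z in s]%fset].
  by apply/seteqP; split=> z /=; rewrite inE.
by apply: (iffP card_eq_fsetP); rewrite card_fseq undup_id.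
Qed.

(** Summing over the two triangles at [x] counts [f x] twice, which turns the constant 4 into 6. *)
Lemma Laplacian_factor f x :
  Laplacian f x = vertex_sum (triangle_sum f) x - 6 * f x.
Proof.
case xl : (rep x) (repP x) => [l i] {}xl.
have tl : tail_eq l omega := address_tail xl.
have tl' : tail_eq (flip (l, i)).1 omega by exact: flip_tail.
have /choice[v vl] j : exists y, address y (l, j) by exact: address_exists.
have /choice[v' v'l] j : exists y, address y ((flip (l, i)).1, j).
  exact: address_exists.
have nb := neighbours_address xl vl v'l.
have sumE l1 i1 (w : 'I_3 -> L) : address x (l1, i1) -> (forall j, address (w j) (l1, j)) ->
    triangle_sum f l1 = f x + \sum_(y <- map w (others i1)) f y.
  move=> xl1 wl1; rewrite big_map (address_fun xl1 (wl1 i1)) (sum_others i1 (fun j => f (w j))).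
  by apply: eq_bigr => j _; rewrite (pullE _ (wl1 j)).
have xl' := address_flip xl; rewrite (surjective_pairing (flip (l, i))) in xl'.
rewrite (vertex_sumE _ xl) /= (sumE _ _ _ xl vl) (sumE _ _ _ xl' v'l).
(* At a fixed code the two triangles coincide, leaving two neighbours, each counted twice. *)
have [fl|fl] := pselect (flip (l, i) = (l, i)).
  have {}nb : neighbours x = [set` map v (others i)].
    rewrite nb fl /=; apply/seteqP; split=> y /=; rewrite mem_cat; last by move=> ->.
    case/orP=> // /mapP[j ji ->]; apply/mapP; exists j => //.
    by apply: (address_fun (v'l j)); rewrite fl.
  have bx : boundary x.
    rewrite /boundary nb; apply/(card_set_seq _ (uniq_corners i vl)).
    by rewrite size_map size_others.
  rewrite /Laplacian asboolT// nb -!fsbig_seq ?(uniq_corners i vl)// -big_distrr /=.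
  have -> : \sum_(y <- map v' (others (flip (l, i)).2)) f y = \sum_(y <- map v (others i)) f y.
    rewrite fl !big_map; apply: eq_bigr => j _; congr f.
    by apply: (address_fun (v'l j)); rewrite fl.
  by ring.
(* Otherwise the two triangles share only [x], giving four distinct neighbours. *)
have us : uniq (map v (others i) ++ map v' (others (flip (l, i)).2)).
  by rewrite cat_uniq (uniq_corners i vl) (uniq_corners _ v'l) corners_disjoint.
have bx : ~ boundary x.
  by rewrite /boundary nb => /(card_set_seq _ us); rewrite size_cat !size_map !size_others.
rewrite /Laplacian asboolF// nb -fsbig_seq// big_cat /=.
by ring.
Qed.

End LatticeOperators.

(** * The spectrum *)

Section InvertibleOperators.
Variables (R : realType) (X : choiceType) (p : \bar R) (x0 : X).
Hypothesis p_ge1 : (1 <= p)%E.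
Implicit Types (T : (X -> R[i]) -> X -> R[i]) (f u : X -> R[i]).

(** The estimate makes [T] injective on l^p, so a chosen right inverse is two-sided, linear and
    bounded there. *)
Lemma invertible_of_bounded_below T : bounded_map p T ->
  (forall a f g, T (fun x => a * f x + g x) = (fun x => a * T f x + T g x)) ->
  (exists2 M, 0 <= M & forall u K, lp p u -> lple p (T u) K -> lple p u (M * K)) ->
  (forall f, lp p f -> exists2 u, lp p u & T u = f) ->
  invertible_operator p T.
Proof.
move=> bT linT [M M0 belowM] ontoT.
have lpnorm_le C f g : 0 <= C -> lp p f -> (forall K, lple p f K -> lple p g (C * K)) ->
    (lpnorm p g <= C%:E * lpnorm p f)%E.
  move=> C0 fp fg; have [K fK ->] := lple_exact p_ge1 fp x0.
  by have [_] := fg K fK; rewrite EFinM.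
have linlp a f g : lp p f -> lp p g -> lp p (fun x => a * f x + g x).
  move=> /lp_lple[K fK] /lp_lple[K' gK']; apply/lp_lple; eexists.
  exact: (lpleD p_ge1 (lpleZ p_ge1 a fK) gK').
have T_inj u v : lp p u -> lp p v -> T u = T v -> u = v.
  move=> up vp uv; pose d x := -1 * v x + u x.
  have dp : lp p d by exact: linlp.
  have : lple p d (M * 0).
    apply: belowM => //; rewrite /d linT uv.
    rewrite (_ : (fun _ => _) = fun=> 0); first exact: lple0.
    by apply/funext => x; rewrite mulN1r addNr.
  rewrite mulr0 => d0; apply/funext => x; apply/eqP; rewrite -subr_eq0 -modulus_eq0.
  have := lple_le p_ge1 x d0; rewrite /d mulN1r addrC => le0.
  by apply/eqP/le_anti; rewrite le0 modulus_ge0.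
have [C C0 TC] := bT.
have Tlp f : lp p f -> lp p (T f) by exact: bounded_map_lp.
split.
  split=> [//|a f g _ _|]; first exact: linT.
  by exists C => f fp; apply: lpnorm_le => // K; exact: TC.
have /choice[S ST] f : exists u, lp p f -> lp p u /\ T u = f.
  have [fp|nfp] := pselect (lp p f); last by exists f.
  by have [u up uf] := ontoT f fp; exists u.
exists S; split.
- split.
  + by move=> f /ST[].
  + move=> a f g fp gp; have [Sf TSf] := ST _ fp; have [Sg TSg] := ST _ gp.
    have [Sfg TSfg] := ST _ (linlp a _ _ fp gp).
    by apply: T_inj; [|exact: linlp|rewrite TSfg linT TSf TSg].
  + exists M => f fp; have [Sf TSf] := ST _ fp; apply: lpnorm_le => // K fK.
    by apply: belowM => //; rewrite TSf.
- by move=> f fp; have [STf TSTf] := ST _ (Tlp _ fp); apply: T_inj.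
- by move=> f /ST[].
Qed.

(** If an inverse had bound [M], an eigenvector of norm [K] at distance at most [1 / (2 (|M| + 1))]
    from [lambda] would satisfy [K <= K / 2]. *)
Lemma spectrum_of_eigenvalues (D : (X -> R[i]) -> X -> R[i]) (lambda : R[i]) :
  (forall e : R, 0 < e -> exists z, modulus (z - lambda) <= e /\
    exists u, [/\ lp p u, (fun x => z * u x + D u x) = (fun=> 0) & exists x, u x != 0]) ->
  spectrum p D lambda.
Proof.
move=> approx [_ [S [[_ _ [M SM]] SK _]]].
have M0 := normr_ge0 M; have MM := ler_norm M.
have [|z [zl [u [up zu [x ux]]]]] := approx (2 * (`|M| + 1))^-1.
  by rewrite invr_gt0; lra.
have Tu : (fun x => lambda * u x + D u x) = (fun x => (lambda - z) * u x).
  apply/funext => y; have := congr1 (@^~ y) zu => /= zuy.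
  by rewrite mulrBl -[RHS]addr0 -zuy; ring.
have [K uK eK] := lple_exact p_ge1 up x.
have vK := lpleZ p_ge1 (lambda - z) uK; rewrite -Tu in vK.
have vp : lp p (fun x => lambda * u x + D u x) by apply/lp_lple; eexists; exact: vK.
have K0 : 0 < K by apply: lt_le_trans (lple_le p_ge1 x uK); rewrite modulus_gt0.
have [L vL eL] := lple_exact p_ge1 vp x.
have := SM _ vp; rewrite SK// eK eL -EFinM lee_fin => KML.
have [_] := vK; rewrite eL lee_fin modulusB => LK.
have L0 : 0 <= L by case: vL.
have : M * L <= `|M| * L by rewrite ler_wpM2r.
have : `|M| * L <= `|M| * ((2 * (`|M| + 1))^-1 * K).
  rewrite ler_wpM2l//; apply: le_trans LK _; rewrite ler_wpM2r// ltW//.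
have -> : `|M| * ((2 * (`|M| + 1))^-1 * K) = (`|M| / (`|M| + 1)) * (K / 2).
  by field; rewrite gt_eqF//; lra.
have : `|M| / (`|M| + 1) * (K / 2) <= 1 * (K / 2).
  by rewrite ler_wpM2r// ?ler_pdivrMr; lra.
by lra.
Qed.

End InvertibleOperators.

(** * Transfer between words and the lattice *)

Section Spectrum.
Variables (R : realType) (omega : word) (p : \bar R).
Hypothesis p_ge1 : (1 <= p)%E.
Local Notation L := (@lattice R omega).
Implicit Types (f u : L -> R[i]) (g h : word -> R[i]).

Lemma lattice_inhabited : exists x : L, True.
Proof. by have [|x _] := @address_exists R omega omega ord0; [exists 0%N|exists x]. Qed.

Let x0 : L := sval (cid lattice_inhabited).

Let point (c : word * 'I_3) : L :=
  if pselect (exists x : L, address x c) is left ex then sval (cid ex) else x0.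

Let pointE (c : word * 'I_3) (x : L) : address x c -> point c = x.
Proof.
move=> xc; rewrite /point; case: pselect => [ex|[]]; last by exists x.
exact: address_fun (svalP (cid ex)) xc.
Qed.

Lemma bounded_triangle_sum : bounded_map p (@triangle_sum R omega).
Proof.
apply: (bounded_map_sum p_ge1 (T := fun i f l => pull f (l, i))) => i.
pose D l := `[< exists x : L, address x (l, i) >].
have -> : (fun f l => pull f (l, i)) =
    fun f l => if l \in D then f (point (l, i)) else 0.
  apply/funext => f; apply/funext => l; rewrite unfold_in /D /pull /point.
  by case: pselect => ex; [rewrite asboolT|rewrite asboolF].
(* For a fixed label, distinct triangles have distinct corners, so one label suffices. *)
apply: (bounded_map_reindex p_ge1 (psi := fun=> ord0)) => l l' /asboolP[x xl] /asboolP[x' xl'].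
rewrite (pointE xl) (pointE xl') => -[xx']; rewrite -xx' in xl'.
have [[]//|e] := address_inj xl xl'.
by have := @flip_snd_fixed l i; rewrite -e => /(_ erefl)[].
Qed.

Lemma rep_inj : injective (@rep R omega).
Proof. by move=> x x' e; apply: address_fun (repP x) _; rewrite e; exact: repP. Qed.

Lemma bounded_vertex_sum : bounded_map p (@vertex_sum R omega).
Proof.
apply: (bounded_mapD p_ge1 (T := fun g x => g (rep x).1) (U := fun g x => g (flip (rep x)).1)).
  apply: (bounded_map_reindexT p_ge1 (psi := fun x : L => (rep x).2)) => x x'.
  by rewrite -!surjective_pairing => /rep_inj.
apply: (bounded_map_reindexT p_ge1 (psi := fun x : L => (flip (rep x)).2)) => x x'.
by rewrite -!surjective_pairing => /flip_inj/rep_inj.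
Qed.

Lemma lambda_Laplacian (lambda : R[i]) f x :
  lambda * f x + Laplacian f x = vertex_sum (triangle_sum f) x - (6 - lambda) * f x.
Proof. by rewrite Laplacian_factor; ring. Qed.

(** The intertwining [T (T^* T - 6 + lambda) = (T T^* - 6 + lambda) T]; off the lattice both sides
    vanish. *)
Lemma triangle_sum_lambda_Laplacian (lambda : R[i]) f l :
  triangle_sum (fun x => lambda * f x + Laplacian f x) l = opW lambda (triangle_sum f) l.
Proof.
have [tl|ntl] := pselect (tail_eq l omega).
  have -> : (fun x => lambda * f x + Laplacian f x) =
      (fun x => - (6 - lambda) * f x + vertex_sum (triangle_sum f) x).
    by apply/funext => x; rewrite lambda_Laplacian; ring.
  by rewrite triangle_sum_linear triangle_sum_vertex_sum// /opW; ring.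
rewrite /opW !triangle_sum_out// mulr0 addr0 /adjW big1// => i _.
rewrite triangle_sum_out// => tl; apply: ntl.
rewrite -[l]/((l, i).1) -(flipK (l, i)) (surjective_pairing (flip (l, i))).
exact: flip_tail.
Qed.

(** A solution of [(lambda + Delta) u = f] is recovered from [h = T u] by
    [(6 - lambda) u = T^* h - f], and [h] solves the equation on words with right-hand side
    [T f]. *)
Lemma Laplacian_invertible (lambda : R[i]) : lambda != 6 -> regularW p lambda ->
  invertible_operator p (fun f x => lambda * f x + @Laplacian R omega f x).
Proof.
move=> l6 [[M M0 belowM] ontoM].
have k0 : 6 - lambda != 0 by rewrite subr_eq0 eq_sym.
have eT : (fun f x => lambda * f x + Laplacian f x) =
    fun f (x : L) => vertex_sum (triangle_sum f) x + - (6 - lambda) * f x.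
  by apply/funext => f; apply/funext => x; rewrite lambda_Laplacian mulNr.
have bvt := bounded_map_comp bounded_triangle_sum bounded_vertex_sum.
have bT : bounded_map p (fun f x => lambda * f x + @Laplacian R omega f x).
  rewrite eT; apply: (bounded_mapD p_ge1 bvt).
  exact: (bounded_mapZ p_ge1 _ (@bounded_map_id _ p _)).
have [C C0 tC] := bounded_triangle_sum; have [D D0 vD] := bounded_vertex_sum.
have solK h f H K : lple p h H -> lple p f K ->
    lple p (fun x => (6 - lambda)^-1 * (vertex_sum h x + -1 * f x))
      (modulus (6 - lambda)^-1 * (4 * (D * H + modulus (-1 : R[i]) * K))).
  by move=> hH fK; apply: lpleZ => //; apply: lpleD => //; [exact: vD|exact: lpleZ].
apply: (invertible_of_bounded_below x0 p_ge1 bT).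
- move=> a f g; apply/funext => x; rewrite !lambda_Laplacian.
  rewrite (_ : triangle_sum _ = fun l => a * triangle_sum f l + triangle_sum g l).
    by rewrite vertex_sum_linear; ring.
  by apply/funext => l; rewrite triangle_sum_linear.
- exists (modulus (6 - lambda)^-1 * (4 * (D * (M * C) + modulus (-1 : R[i])))).
    by rewrite mulr_ge0 ?modulus_ge0// mulr_ge0// addr_ge0 ?modulus_ge0// !mulr_ge0.
  move=> u K up uK.
  have tK : lple p (triangle_sum u) (M * (C * K)).
    apply: belowM; first exact: bounded_map_lp bounded_triangle_sum up.
    have := tC _ _ uK; congr lple; apply/funext => l.
    exact: triangle_sum_lambda_Laplacian.
  have := solK _ _ _ _ tK uK; congr lple; last by ring.
  by apply/funext => x; rewrite lambda_Laplacian; field.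
move=> f fp; have [h hp hf] := ontoM _ (bounded_map_lp bounded_triangle_sum fp).
pose g := fun x : L => (6 - lambda)^-1 * (vertex_sum h x + -1 * f x).
exists g.
  have [/lp_lple[H hH] /lp_lple[K fK]] := (hp, fp).
  by apply/lp_lple; eexists; exact: solK hH fK.
have gE : g = fun x => - (6 - lambda)^-1 * f x +
    ((6 - lambda)^-1 * vertex_sum h x + 0).
  by apply/funext => x; rewrite /g; ring.
(* The equation for [h] gives [T T^* h - T f = (6 - lambda) h], hence [T g = h]. *)
have th l : tail_eq l omega -> triangle_sum g l = h l.
  move=> tl; rewrite gE triangle_sum_linear triangle_sum_linear triangle_sum_vertex_sum//.
  rewrite -hf /opW (_ : triangle_sum (fun=> 0) l = 0); first by field.
  by rewrite /triangle_sum big1// => i _; rewrite /pull; case: pselect.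
apply/funext => x; rewrite lambda_Laplacian (eq_vertex_sum _ th) /g.
by field.
Qed.

(** The eigenfunction is [T^* u]; it is nonzero because [T T^* u = (6 - lambda) u] on the
    lattice. *)
Lemma eigenvalueW_Laplacian (lambda : R[i]) : lambda != 6 -> eigenvalueW p lambda omega ->
  exists f, [/\ lp p f, (fun x => lambda * f x + Laplacian f x) = (fun=> 0) &
                exists x : L, f x != 0].
Proof.
move=> l6 [u [up u0 [l tl ul]]]; exists (vertex_sum u).
have tu m : tail_eq m omega -> triangle_sum (@vertex_sum R omega u) m = (6 - lambda) * u m.
  move=> tm; rewrite triangle_sum_vertex_sum//.
  have := congr1 (@^~ m) u0; rewrite /opW /= => um.
  by rewrite -[RHS]addr0 -um; ring.
split.
- exact: bounded_map_lp bounded_vertex_sum up.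
- apply/funext => x; rewrite lambda_Laplacian.
  rewrite (@eq_vertex_sum _ _ _ (fun m => (6 - lambda) * u m + 0)); last first.
    by move=> m /tu ->; rewrite addr0.
  by rewrite vertex_sum_linear /vertex_sum; ring.
- apply: contrapT => no; have := tu l tl.
  rewrite /triangle_sum big1 => [/esym/eqP|i _].
    by rewrite mulf_eq0 (negbTE ul) orbF subr_eq0 eq_sym (negbTE l6).
  rewrite /pull; case: pselect => // ex; apply/eqP; apply: contrapT => /negP f0.
  by apply: no; eexists; exact: f0.
Qed.

(** A function with zero sum on every triangle is killed by [T], hence by [6 + Delta]; the tail [t]
    places the hexagon in this lattice. *)
Lemma Laplacian_eigenvalue6 :
  exists f, [/\ lp p f, (fun x => 6 * f x + Laplacian f x) = (fun=> 0) &
                exists x : L, f x != 0].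
Proof.
pose t := shift (shift omega); pose f (x : L) := hexagon R t (rep x).
have fE x c : address x c -> f x = hexagon R t c.
  by move=> xc; case: (address_inj xc (repP x)) => e; rewrite /f e ?hexagon_flip.
exists f; split.
- pose s := [seq point (c, i) | c <- [seq consw a (consw b t) | a <- enum 'I_3, b <- enum 'I_3],
                                i <- enum 'I_3].
  apply: (lp_fin_supp p_ge1 (s := s)) => x; apply: contraNeq.
  rewrite /f (surjective_pairing (rep x)) => /hexagon_supp ex.
  rewrite -(pointE (repP x)) (surjective_pairing (rep x)) ex.
  apply: allpairs_f; last by rewrite mem_enum.
  by apply: allpairs_f; rewrite mem_enum.
- apply/funext => x; rewrite lambda_Laplacian subrr mul0r subr0.
  rewrite (@eq_vertex_sum _ _ _ (fun=> 0)); first by rewrite /vertex_sum addr0.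
  move=> l tl; rewrite /triangle_sum (eq_bigr (fun i => hexagon R t (l, i))) => [|i _].
    exact: hexagon_sum.
  by have [y yl] := @address_exists R omega l i tl; rewrite (pullE _ yl) (fE _ _ yl).
- have [|x xl] := @address_exists R omega (consw ord0 (consw ord_max t)) ord0.
    by exists 2%N => -[|[|]].
  by exists x; rewrite (fE _ _ xl) hexagon_consw ?oner_eq0.
Qed.

Lemma regularW_iter n (lambda : R[i]) :
  (forall k, iter k (@Rmap R) lambda != 3) -> (forall k, iter k (@Rmap R) lambda != 5) ->
  regularW p (iter n (@Rmap R) lambda) -> regularW p lambda.
Proof.
elim: n lambda => [//|n IHn] lambda no3 no5; rewrite iterSr => reg.
apply: (regularW_decim p_ge1 (no3 0%N) (no5 0%N)).
by apply: IHn => // k; rewrite -iterSr.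
Qed.

Lemma spectrum_Laplacian :
  spectrum p (@Laplacian R omega) = @bounded_orbit R `|` @Sigma6 R.
Proof.
apply/seteqP; split=> lambda.
  move=> spec; apply: contrapT => /not_orP[unb /not_orP[l6 l3]]; apply: spec.
  apply: Laplacian_invertible; first exact/eqP.
  have [B farB] := regularW_far p_ge1.
  (* The margin 1/2 is the distance from the centre 5/2 to 3. *)
  have [n nB] := orbit_escapes unb (B + 1 / 2).
  apply: (@regularW_iter n).
  - by move=> k; apply/eqP => k3; apply: l3; exists k.
  - by move=> k; apply/eqP => /bounded_orbit_preim5.
  apply: farB; have := modulusD (iter n (@Rmap R) lambda - 3) (1 / 2).
  rewrite (modulus_frac R 1 2) (_ : _ - 3 + 1 / 2 = iter n (@Rmap R) lambda - 5 / 2); last by field.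
  by lra.
have neq6 z n : iter n (@Rmap R) z = 3 -> z != 6.
  by move=> zn; apply/eqP => z6; have := iter_Rmap6_neq3 R n; rewrite -z6 zn eqxx.
move=> lambdaS; apply: (spectrum_of_eigenvalues p_ge1) => e e0.
case: lambdaS => [bl|[->|[n _ nl]]].
- have [z [zl [n nz]]] := preimages_of_3_approach bl e0; exists z; split=> //.
  apply: eigenvalueW_Laplacian; first exact: neq6 nz.
  exact: (eigenvalueW_preim3 p_ge1 _ nz).
- exists 6; split; first by rewrite subrr modulus0 ltW.
  exact: Laplacian_eigenvalue6.
- exists lambda; split; first by rewrite subrr modulus0 ltW.
  apply: eigenvalueW_Laplacian; first exact: neq6 nl.
  exact: (eigenvalueW_preim3 p_ge1 _ nl).
Qed.

End Spectrum.

Theorem theorem2p2 (R : realType) (omega : nat -> 'I_3) (p : \bar R)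
    (hp : (1 <= p)%E) :
  Some @` spectrum p (@Laplacian R omega) =
  Julia (@Rsphere R) `|` Some @` @Sigma6 R.
Proof. by rewrite Julia_Rsphere spectrum_Laplacian// image_setU. Qed.
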